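(* There is an absolute constant $c>0$ such that for every positive integer $n$ divisible by $3$ and every $3$-decomposable set $P$ of $n$ points in general position in the plane, \[ \overline{\mathrm{cr}}(P)\;\geq\;\frac{2}{27}\left(15-\pi^{2}\right)\binom{n}{4}-c\,n^{3}. \] (In the paper's notation: $\overline{\mathrm{cr}}(P)\geq \frac{2}{27}(15-\pi^2)\binom{n}{4}+\Theta(n^3)>0.380029\binom{n}{4}+\Theta(n^3)$.)
   Context: For a finite point set $P$ in general position in the plane, $\overline{\mathrm{cr}}(P)$ denotes the number of crossings in the complete geometric graph on $P$ (all $\binom{|P|}{2}$ straight-line segments between points of $P$); equivalently, the number of $4$-element subsets of $P$ in convex position. A finite point set $P$ (with $|P|$ divisible by $3$) is $3$-decomposable if it can be partitioned into three sets $A,B,C$ of equal size such that there is a triangle $T$ enclosing $P$ for which the orthogonal projections of $P$ onto the three sides of $T$ show: on one side, the projection of $A$ lies between the projections of $B$ and of $C$ (i.e. all projected points of $B$ lie on one side of all projected points of $A$ and all projected points of $C$ lie on the other); on another side, $B$ lies between $A$ and $C$ in this sense; and on the third side, $C$ lies between $A$ and $B$. *)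

(* Defs.v *)
From HB Require Import structures.
From mathcomp Require Import all_boot all_order all_algebra.
From mathcomp Require Import finmap.
From mathcomp Require Import boolp classical_sets reals.

Set Implicit Arguments.
Unset Strict Implicit.
Unset Printing Implicit Defensive.

Import Order.TTheory GRing.Theory Num.Theory.
Local Open Scope ring_scope.

Definition dotp (R : realType) (u v : 'rV[R]_2) : R :=
  \sum_(i < 2) u 0 i * v 0 i.

Definition collinear (R : realType) (p q r : 'rV[R]_2) : Prop :=
  exists a d : 'rV[R]_2, d != 0 /\
    forall x, x \in [:: p; q; r] -> exists s : R, x = a + s *: d.

Definition general_position (R : realType) (P : {fset 'rV[R]_2}) : Prop :=
  forall p q r : 'rV[R]_2, p \in P -> q \in P -> r \in P ->
    p != q -> q != r -> p != r -> ~ collinear p q r.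

Definition edges (R : realType) (P : {fset 'rV[R]_2}) :
    {fset {fset 'rV[R]_2}} :=
  [fset e in fpowerset P | #|` e| == 2%N]%fset.

Definition open_segment (R : realType) (e : {fset 'rV[R]_2}) :
    set 'rV[R]_2 :=
  [set x | exists a b : 'rV[R]_2, exists t : R,
     [/\ e = [fset a; b]%fset, 0 < t < 1 & x = (1 - t) *: a + t *: b]]%classic.

(* For points in general position, two distinct edges sharing an endpoint have
   disjoint relative interiors, so only edges on four points can cross. *)
Definition cross (R : realType) (e f : {fset 'rV[R]_2}) : Prop :=
  exists x : 'rV[R]_2, open_segment e x /\ open_segment f x.

(* Unordered pairs of crossing edges: a point where several edges meet counts
   once per pair. *)
Definition crossing_number (R : realType) (P : {fset 'rV[R]_2}) : nat :=
  #|` [fset X in fpowerset (edges P) |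
        `[< exists e f, [/\ X = [fset e; f]%fset, e != f & cross e f] >]]%fset|.

Definition in_triangle (R : realType) (t0 t1 t2 x : 'rV[R]_2) : Prop :=
  exists a b c : R, [/\ 0 <= a, 0 <= b & 0 <= c] /\
    a + b + c = 1 /\ x = a *: t0 + b *: t1 + c *: t2.

(* The orthogonal projection of p onto the line through s and t (s != t) is
   s + proj_coord s t p *: (t - s), so this coordinate orders the projected
   points along that line. *)
Definition proj_coord (R : realType) (s t p : 'rV[R]_2) : R :=
  dotp (p - s) (t - s) / dotp (t - s) (t - s).

Definition proj_before (R : realType) (s t : 'rV[R]_2)
    (X Y : {fset 'rV[R]_2}) : Prop :=
  forall x y : 'rV[R]_2, x \in X -> y \in Y ->
    proj_coord s t x < proj_coord s t y.

Definition proj_between (R : realType) (s t : 'rV[R]_2)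
    (X Y Z : {fset 'rV[R]_2}) : Prop :=
  (proj_before s t Y X /\ proj_before s t X Z) \/
  (proj_before s t Z X /\ proj_before s t X Y).

(* The vertices of the triangle may be relabelled arbitrarily, so it is no
   restriction to name the side on which each class is in the middle. *)
Definition three_decomposable (R : realType) (P : {fset 'rV[R]_2}) : Prop :=
  exists A B C : {fset 'rV[R]_2},
    [/\ P = (A `|` B `|` C)%fset,
        [/\ [disjoint A & B]%fset, [disjoint B & C]%fset
          & [disjoint A & C]%fset],
        #|` A| = #|` B| /\ #|` B| = #|` C|
      & exists t0 t1 t2 : 'rV[R]_2,
          [/\ ~ collinear t0 t1 t2,
              forall p, p \in P -> in_triangle t0 t1 t2 p,
              proj_between t0 t1 A B C,
              proj_between t1 t2 B A C
            & proj_between t2 t0 C A B]].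

(* Main.v *)
(* With [l] points on one side of the line [pq] and [n - 2 - l] on the other,
   counting 4-subsets by separated pairs gives
   cr(P) >= 3 C(n,4) - sum over pairs of l (n - 2 - l), so the sum over pairs
   must be bounded above.  All that 3-decomposability is used for is that each
   class A, of size m = n/3, is strictly extreme in some direction.  Rotate that
   direction by a half-turn and follow the rank of a point a of A among the
   projections: each q outside A moves a up, and a pair inside A moves one of
   its points up and the other one down.  Summing over A, the pairs inside A
   cancel, which gives the contribution of the pairs leaving A exactly.  For the
   pairs inside A, keep those with rank in a central window of width M: as the
   window is crossed at most once upwards, they form an acyclic digraph with
   outdegree <= indegree + M.  Cutting its m vertices into consecutive blocks
   bounds the number of arcs by
   m^2/2 - sum_j (m - j(j+1)M/2)_+^2 / (2j(j+1)) + O(m),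
   and summing M times this over all windows produces sum_j 1/(j(j+1))^3,
   which is 10 - pi^2. *)
Require Import Defs.
From HB Require Import structures.
From mathcomp Require Import all_boot all_order all_algebra.
From mathcomp Require Import finmap.
From mathcomp Require Import boolp classical_sets reals trigo.
From mathcomp Require Import topology normedtype derive realfun.
From mathcomp Require Import ring lra zify.

Set Implicit Arguments.
Unset Strict Implicit.
Unset Printing Implicit Defensive.

Import Order.TTheory GRing.Theory Num.Theory.
Import numFieldNormedType.Exports.
Local Open Scope ring_scope.

(** * A walk and its levels *)

(* A walk starts at height [count (predC up) s] and meets the elements of [s] by
   increasing [key], stepping up or down at [q] according to [up q];
   [level key up s q] is the lower end of the step at [q]. *)
Definition level (R : realDomainType) (T : eqType) (key : T -> R) (up : pred T)
    (s : seq T) (q : T) : nat :=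
  (count (fun r => up r && (key r < key q)%R) s
   + count (fun r => ~~ up r && (key q < key r)%R) s)%N.

(** Read in the order of [s], the sum telescopes along the walk. The offset [b] makes the induction
    go through: removing the first element lowers the level of every later one by [up q], and [b]
    absorbs this shift. *)
Lemma walk_sorted (R : realDomainType) (V : zmodType) (T : eqType)
    (key : T -> R) (up : pred T) (G : nat -> V) (s : seq T) (b : nat) :
  sorted (fun x y => key x < key y) s ->
  \sum_(q <- s) (if up q then G (b + level key up s q).+1%N - G (b + level key up s q)%N
                 else G (b + level key up s q)%N - G (b + level key up s q).+1%N)
    = G (b + count up s)%N - G (b + count (predC up) s)%N.
Proof.
have tr : transitive (fun x y : T => key x < key y).
  by move=> y x z; apply: lt_trans.
elim: s b => [|q s IH] b; first by rewrite big_nil !addn0 subrr.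
move=> /= sq; have ss := path_sorted sq.
have qs : all (fun y => key q < key y) s by apply: (order_path_min tr).
have lq : level key up (q :: s) q = count (predC up) s.
  rewrite /level /= ltxx !andbF !add0n.
  rewrite (eq_in_count (a2 := pred0)) ?count_pred0 ?add0n; last first.
    by move=> x /(allP qs) /ltW; rewrite leNgt => /negbTE ->; rewrite andbF.
  by apply: eq_in_count => x /(allP qs) ->; rewrite andbT.
have ls x : x \in s -> level key up (q :: s) x = (up q + level key up s x)%N.
  move=> xs; have qx := allP qs _ xs.
  by rewrite /level /= qx [_ < key q]ltNge (ltW qx) !andbF andbT add0n addnA.
rewrite big_cons lq.
under eq_big_seq => x xs do rewrite ls // addnA.
rewrite IH //=; case: ifP => uq /=; rewrite ?addn0 ?addn1 ?add0n ?add1n ?addnS ?addSn.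
  by rewrite addrC addrA subrK.
by rewrite addrC addrA subrK.
Qed.

(** Neither side depends on the order of [s], so [s] may be sorted by [key]; injectivity of [key] on
    [s] makes the sorted order strict. *)
Lemma walk (R : realDomainType) (V : zmodType) (T : eqType)
    (key : T -> R) (up : pred T) (G : nat -> V) (s : seq T) :
  uniq s -> {in s &, injective key} ->
  \sum_(q <- s) (if up q then G (level key up s q).+1 - G (level key up s q)
                 else G (level key up s q) - G (level key up s q).+1)
    = G (count up s) - G (count (predC up) s).
Proof.
move=> us kinj.
pose le (x y : T) := key x <= key y.
have ps : perm_eq (sort le s) s by apply/permPl/perm_sort.
have lE q : level key up s q = level key up (sort le s) q.
  by rewrite /level !(permP ps).
under eq_bigr do rewrite lE.
rewrite -(perm_big _ ps) /= -!(permP ps) (@walk_sorted _ _ _ _ _ G _ 0%N) //.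
have us' : uniq (sort le s) by rewrite (perm_uniq ps).
have : sorted le (sort le s) by apply: sort_sorted => x y; apply: le_total.
have : {in sort le s &, injective key}.
  by move=> x y; rewrite !(perm_mem ps); apply: kinj.
elim: (sort le s) us' => //= x t IH /andP[xt ut] inj.
have tr : transitive le by move=> y z w; apply: le_trans.
move=> pt; have := order_path_min tr pt; move/path_sorted: pt => st /allP mt.
have -> : path (fun x y => key x < key y) x t
    = (all (fun y => key x < key y) t && sorted (fun x y => key x < key y) t).
  by apply: path_sortedE => y z w; apply: lt_trans.
rewrite IH //; last by move=> y z yt zt; apply: inj; rewrite inE ?yt ?zt orbT.
rewrite andbT; apply/allP => y yt; rewrite lt_neqAle (mt _ yt : key x <= key y) andbT.
apply/eqP => /inj; rewrite !inE eqxx yt orbT => /(_ isT isT) xy.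
by rewrite xy yt in xt.
Qed.

(** * Acyclic digraphs with bounded outdegree excess *)

Definition arcs (E : rel nat) (m : nat) : nat :=
  (\sum_(0 <= i < m) \sum_(0 <= j < m) E i j)%N.

Definition near_balanced (E : rel nat) (M m : nat) : Prop :=
  forall i, (i < m)%N ->
    (\sum_(0 <= j < m) E i j <= \sum_(0 <= j < m) E j i + M)%N.

Lemma arcs_block (E : rel nat) (c d : nat) :
  (forall i j, E i j -> (i < j)%N) ->
  (\sum_(c <= i < c + d) \sum_(c <= j < c + d) E i j <= 'C(d, 2))%N.
Proof.
move=> El; elim: d => [|d IH]; first by rewrite addn0 big_geq.
have row0 : (\sum_(c <= j < (c + d).+1) E (c + d)%N j = 0)%N.
  rewrite big_nat_cond big1 // => j; rewrite andbT => /andP[_ jd].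
  by case: (E _ _) (El (c + d)%N j) => // /(_ isT); lia.
rewrite addnS big_nat_recr ?leq_addr //= row0 addn0.
under eq_bigr do rewrite big_nat_recr ?leq_addr //=.
rewrite big_split /= binS bin1 leq_add //.
rewrite (@leq_trans (\sum_(c <= i < c + d) 1)) ?leq_sum //.
  by move=> i _; case: (E _ _).
by rewrite sum_nat_const_nat muln1 addKn.
Qed.

(* The arcs leaving the first [c] vertices number the sum of the excesses
   outdegree - indegree over these vertices. *)
Lemma arcs_cut (E : rel nat) (M c d : nat) :
  (forall i j, E i j -> (i < j)%N) -> near_balanced E M (c + d) ->
  (arcs E (c + d) <= 'C(d, 2) + M * c + arcs E c)%N.
Proof.
move=> El bal.
have low (F : nat -> nat -> nat) : (forall i j, (c <= i)%N -> (j < c)%N -> F i j = 0%N) ->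
    (\sum_(c <= i < c + d) \sum_(0 <= j < c + d) F i j
      = \sum_(c <= i < c + d) \sum_(c <= j < c + d) F i j)%N.
  move=> F0; apply: eq_big_nat => i /andP[ci _].
  rewrite (big_cat_nat (n := c)) ?leq_addr //= big_nat_cond big1 //.
  by move=> j; rewrite andbT => /andP[_ jc]; rewrite F0.
have E0 i j : (c <= i)%N -> (j < c)%N -> E i j = false.
  by move=> ci jc; apply/negP => /El; rewrite ltnNge (leq_trans (ltnW jc) ci).
have splitin : (\sum_(0 <= i < c) \sum_(0 <= j < c + d) E i j
                 <= \sum_(0 <= i < c) \sum_(0 <= j < c + d) E j i + M * c)%N.
  rewrite -[c in (M * c)%N]subn0 mulnC -sum_nat_const_nat -big_split /=.
  rewrite big_nat_cond [leqRHS]big_nat_cond leq_sum // => i.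
  by rewrite andbT => /andP[_ ic]; apply: bal; rewrite (leq_trans ic) ?leq_addr.
have -> : arcs E (c + d) = (\sum_(0 <= i < c) \sum_(0 <= j < c + d) E i j
    + \sum_(c <= i < c + d) \sum_(c <= j < c + d) E i j)%N.
  rewrite /arcs (big_cat_nat (n := c)) ?leq_addr //=; congr addn.
  by apply: low => i j ci jc; rewrite E0.
have -> : ('C(d, 2) + M * c + arcs E c = (arcs E c + M * c) + 'C(d, 2))%N by lia.
rewrite leq_add ?arcs_block // (leq_trans splitin) // leq_add2r.
rewrite exchange_big_nat /= (big_cat_nat (n := c)) ?leq_addr //=.
rewrite [X in (_ + X <= _)%N]big_nat_cond [X in (_ + X <= _)%N]big1 ?addn0 //.
move=> i; rewrite andbT => /andP[ci _]; rewrite big_nat_cond big1 // => j.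
by rewrite andbT => /andP[_ jc]; rewrite E0.
Qed.

(** Arcs go forward, so a vertex of the prefix keeps its whole indegree when the later vertices are
    removed, while its outdegree can only drop. *)
Lemma near_balanced_prefix (E : rel nat) (M c d : nat) :
  (forall i j, E i j -> (i < j)%N) -> near_balanced E M (c + d) ->
  near_balanced E M c.
Proof.
move=> El bal i ic; have := bal i (ltn_addr d ic).
have <- : (\sum_(0 <= j < c + d) E j i = \sum_(0 <= j < c) E j i)%N.
  rewrite (big_cat_nat (n := c)) ?leq_addr //= [X in (_ + X)%N]big_nat.
  rewrite [X in (_ + X)%N]big1 ?addn0 // => j /andP[cj _].
  by apply/eqP; rewrite eqb0; apply/negP => /El; rewrite ltnNge (leq_trans (ltnW ic) cj).
by apply: leq_trans; rewrite [leqRHS](big_cat_nat (n := c)) ?leq_addr.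
Qed.

(* Iterating [arcs_cut] along [l] cuts, the best block sizes form an arithmetic
   progression of difference [M]; this is the value of the resulting bound. *)
Definition arc_bound (R : realFieldType) (M : R) (l : nat) (x : R) : R :=
  x ^+ 2 / 2 - \sum_(1 <= j < l.+1)
    (x - (j * j.+1)%:R / 2 * M) ^+ 2 / (2 * (j * j.+1)%:R).

(** With the sum over [j] evaluated, the induction step of [arcs_le] becomes an identity between
    rational functions. *)
Lemma arc_bound_closed (R : realFieldType) (M : R) (l : nat) (x : R) :
  arc_bound M l x = ((x + (l * l.+1)%:R / 2 * M) ^+ 2 / l.+1%:R
    - M ^+ 2 * (l * l.+1 * l.*2.+1)%:R / 6) / 2.
Proof.
elim: l => [|l IH].
  by rewrite /arc_bound big_geq // !mul0n !mul0r !mulr0 subr0 addr0 divr1 mul0r subr0.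
have -> : arc_bound M l.+1 x = arc_bound M l x
    - (x - (l.+1 * l.+2)%:R / 2 * M) ^+ 2 / (2 * (l.+1 * l.+2)%:R).
  by rewrite /arc_bound big_nat_recr //= opprD addrA.
rewrite IH -!muln2 !(natrM, mulrS).
have l0 : 0 <= l%:R :> R by [].
move: l%:R l0 => y y0.
by field; apply/andP; split; apply: lt0r_neq0; lra.
Qed.

Lemma bin2R (R : realFieldType) (d : nat) : 'C(d, 2)%:R = d%:R * (d%:R - 1) / 2 :> R.
Proof.
have := congr1 (GRing.natmul (1 : R)) (mul_bin_diag d 1).
case: d => [|d]; first by rewrite mul0r mul0r.
rewrite /= bin1 !natrM => E.
apply: (mulfI (_ : 2 != 0)); first by rewrite pnatr_eq0.
by rewrite -E -[d.+1%:R]natr1; field.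
Qed.

(** The real cut minimizing [(m - c)^2 / 2 + M * c + arc_bound M l c] is
    [c = (l+1) * (m - (l+2) * M / 2) / (l+2)]. Here [c] is its integer part and [r] the remainder of
    the division; the hypothesis keeps [c] in the range where [l] further cuts are allowed. *)
Lemma cut_point (l m M : nat) : (l.+1 * l.+2 * M <= m.*2)%N ->
  exists c r : nat, [/\ (c <= m)%N, (l * l.+1 * M <= c.*2)%N, (r < l.+2.*2)%N
    & (l.+1 * m.*2 = c * l.+2.*2 + r + l.+1 * l.+2 * M)%N].
Proof.
move=> lM; pose num := (l.+1 * m.*2 - l.+1 * l.+2 * M)%N.
have lM' : (l.+1 * l.+2 * M <= l.+1 * m.*2)%N.
  by rewrite (leq_trans lM) // leq_pmull.
exists (num %/ l.+2.*2)%N, (num %% l.+2.*2)%N; split.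
- rewrite -ltnS ltn_divLR ?double_gt0 //; apply: (leq_ltn_trans (leq_subr _ _)).
  by clear; rewrite -!muln2; nia.
- have tE : (l * l.+1 = (l * l.+1)./2.*2)%N.
    by rewrite -[LHS]odd_double_half oddM /= andbN add0n.
  rewrite tE -doubleMl leq_double leq_divRL //.
  have -> : ((l * l.+1)./2 * M * l.+2.*2 = (l * l.+1)./2.*2 * M * l.+2)%N.
    by rewrite -!muln2; ring.
  rewrite -tE leq_subRL //; apply: leq_trans (leq_mul (leqnn l.+1) lM).
  by rewrite leq_eqVlt; apply/orP; left; apply/eqP; ring.
- by rewrite ltn_mod double_gt0.
- by rewrite -divn_eq subnK.
Qed.

(** Induction on the number of cuts: [arcs_cut] splits off a last block, and the induction
    hypothesis handles the first [c] vertices. Each cut loses at most 1 to rounding, whence the term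
    [l%:R]. *)
Lemma arcs_le (R : realFieldType) (E : rel nat) (M m l : nat) :
  (forall i j, E i j -> (i < j)%N) -> near_balanced E M m ->
  (l * l.+1 * M <= m.*2)%N ->
  (arcs E m)%:R <= arc_bound M%:R l m%:R + l%:R :> R.
Proof.
move=> El; elim: l m => [|l IH] m bal lM.
  have := @arcs_block E 0 m El; rewrite add0n -/(arcs E m) addr0.
  rewrite /arc_bound big_geq // subr0 -(ler_nat R) => /le_trans; apply.
  have m0 : 0 <= m%:R :> R by [].
  rewrite bin2R; lra.
have [c [r [cm cl rl cE]]] := cut_point lM.
have bal' := bal; rewrite -(subnKC cm) in bal'.
have := arcs_cut El bal'; have := IH c (near_balanced_prefix El bal') cl.
rewrite subnKC // => IHc.
rewrite -(ler_nat R) !natrD bin2R natrM natrB // => /le_trans; apply.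
apply: (le_trans (lerD (lexx _) IHc)).
rewrite !arc_bound_closed.
have cER : l.+1%:R * (m%:R * 2)
    = c%:R * (l.+2%:R * 2) + r%:R + l.+1%:R * l.+2%:R * M%:R :> R.
  by rewrite -!natrM -!natrD !muln2 cE.
(* The amount by which rounding lowers the optimal real cut. *)
pose d : R := r%:R / (2 * l.+2%:R).
have d0 : 0 <= d by rewrite divr_ge0 // mulr_ge0.
have d1 : d <= 1.
  rewrite ler_pdivrMr ?mul1r ?mulr_gt0 ?ltr0n // -natrM ler_nat mul2n.
  exact: ltnW.
have cmR : c%:R <= m%:R :> R by rewrite ler_nat.
clear - cER d0 d1 cmR.
have l0 : 0 <= l%:R :> R by [].
have cE' : c%:R = l.+1%:R * (m%:R - l.+2%:R * M%:R / 2) / l.+2%:R - d :> R.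
  rewrite /d.
  have -> : r%:R = l.+1%:R * (m%:R * 2) - c%:R * (l.+2%:R * 2) - l.+1%:R * l.+2%:R * M%:R :> R.
    by rewrite cER; ring.
  by field; apply: lt0r_neq0; lra.
have dd : (1 + l.+1%:R^-1) * d ^+ 2 / 2 <= 1.
  have : l.+1%:R^-1 <= 1 :> R by rewrite invf_le1 ?ltr0n // ler1n.
  have : 0 <= l.+1%:R^-1 :> R by rewrite invr_ge0.
  have : d ^+ 2 <= 1 by rewrite expr_le1.
  have : 0 <= d ^+ 2 by rewrite exprn_ge0.
  move: (d ^+ 2) (l.+1%:R^-1) => x y; clear; nra.
(* In [c] the main terms form a quadratic with leading coefficient [(1 + l.+1%:R^-1) / 2], minimal
   at the real cut with value [arc_bound M%:R l.+1 m%:R]. Rounding thus costs exactly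
   [(1 + l.+1%:R^-1) * d ^+ 2 / 2]; the last term is the linear part of the binomial coefficient. *)
apply: (@le_trans _ _ (((m%:R + (l.+1 * l.+2)%:R / 2 * M%:R) ^+ 2 / l.+2%:R
    - M%:R ^+ 2 * (l.+1 * l.+2 * (l.+1).*2.+1)%:R / 6) / 2 + l%:R
    + (1 + l.+1%:R^-1) * d ^+ 2 / 2 - (m%:R - c%:R) / 2)); last first.
  have aux (V t u L : R) : t <= 1 -> 0 <= u -> V + L + t - u / 2 <= V + (1 + L).
    by lra.
  by rewrite [l.+1%:R in X in _ <= _ + X]mulrS; apply: aux; rewrite // subr_ge0.
rewrite le_eqVlt; apply/orP; left; apply/eqP.
rewrite cE' -!muln2 !(natrM, mulrS).
move: l%:R l0 m%:R M%:R d {cER cE' d0 d1 dd cmR} => x x0 y z d.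
field; apply/andP; split; apply: lt0r_neq0; lra.
Qed.

(** * Bounds on pi and on the sum of inverse cubes of pronic numbers *)

Lemma le_of_derive (R : realType) (f g df dg : R -> R) (x : R) :
  (forall y : R, is_derive y 1 f (df y)) ->
  (forall y : R, is_derive y 1 g (dg y)) ->
  f 0 <= g 0 -> (forall y : R, 0 <= y -> df y <= dg y) -> 0 <= x -> f x <= g x.
Proof.
move=> Hf Hg fg0 dle x0.
have H (y : R) : is_derive y 1 (g \- f) (dg y - df y) by apply: is_deriveB.
have [|c] := MVT_segment x0 (fun y _ => H y).
  by apply: derivable_within_continuous => y _; have /@ex_derive := H y.
rewrite in_itv /= => /andP[c0 _] /= E.
have := dle c c0; rewrite -subr_ge0 => d.
have : 0 <= (dg c - df c) * (x - 0) by rewrite mulr_ge0 // subr0.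
rewrite -E; lra.
Qed.

(** First of a chain: starting from [cos <= 1], each use of [le_of_derive] integrates the previous
    bound, up to the Taylor bound of degree 7 on which [pi_lt] rests. *)
Lemma sin_le_id (R : realType) (x : R) : 0 <= x -> sin x <= x.
Proof.
apply: (@le_of_derive R sin id cos (fun=> 1)) => [|y _]; last exact: cos_le1.
by rewrite sin0.
Qed.

Lemma cos_ge_taylor2 (R : realType) (x : R) : 0 <= x -> 1 - x ^+ 2 / 2 <= cos x.
Proof.
have H (y : R) : is_derive y 1 (fun x : R => 1 - x ^+ 2 / 2) (- y).
  by apply: is_derive_eq; rewrite /GRing.scale /=; field.
apply: (le_of_derive H) => [|y y0]; last by rewrite lerN2 sin_le_id.
by rewrite cos0; lra.
Qed.

Lemma sin_ge_taylor3 (R : realType) (x : R) : 0 <= x -> x - x ^+ 3 / 6 <= sin x.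
Proof.
have H (y : R) : is_derive y 1 (fun x : R => x - x ^+ 3 / 6) (1 - y ^+ 2 / 2).
  by apply: is_derive_eq; rewrite /GRing.scale /=; field.
apply: (le_of_derive H) => [|y y0]; last exact: cos_ge_taylor2.
by rewrite sin0; lra.
Qed.

Lemma cos_le_taylor4 (R : realType) (x : R) : 0 <= x ->
  cos x <= 1 - x ^+ 2 / 2 + x ^+ 4 / 24.
Proof.
have H (y : R) : is_derive y 1 (fun x : R => 1 - x ^+ 2 / 2 + x ^+ 4 / 24)
    (- (y - y ^+ 3 / 6)).
  by apply: is_derive_eq; rewrite /GRing.scale /=; field.
apply: (fun H1 => le_of_derive H1 H) => [|y y0].
  by rewrite cos0; lra.
by rewrite lerN2 sin_ge_taylor3.
Qed.

Lemma sin_le_taylor5 (R : realType) (x : R) : 0 <= x ->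
  sin x <= x - x ^+ 3 / 6 + x ^+ 5 / 120.
Proof.
have H (y : R) : is_derive y 1 (fun x : R => x - x ^+ 3 / 6 + x ^+ 5 / 120)
    (1 - y ^+ 2 / 2 + y ^+ 4 / 24).
  by apply: is_derive_eq; rewrite /GRing.scale /=; field.
apply: (fun H1 => le_of_derive H1 H) => [|y y0]; last exact: cos_le_taylor4.
by rewrite sin0; lra.
Qed.

Lemma cos_ge_taylor6 (R : realType) (x : R) : 0 <= x ->
  1 - x ^+ 2 / 2 + x ^+ 4 / 24 - x ^+ 6 / 720 <= cos x.
Proof.
have H (y : R) : is_derive y 1
    (fun x : R => 1 - x ^+ 2 / 2 + x ^+ 4 / 24 - x ^+ 6 / 720)
    (- (y - y ^+ 3 / 6 + y ^+ 5 / 120)).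
  by apply: is_derive_eq; rewrite /GRing.scale /=; field.
apply: (le_of_derive H) => [|y y0]; first by rewrite cos0; lra.
by rewrite lerN2 sin_le_taylor5.
Qed.

Lemma sin_ge_taylor7 (R : realType) (x : R) : 0 <= x ->
  x - x ^+ 3 / 6 + x ^+ 5 / 120 - x ^+ 7 / 5040 <= sin x.
Proof.
have H (y : R) : is_derive y 1
    (fun x : R => x - x ^+ 3 / 6 + x ^+ 5 / 120 - x ^+ 7 / 5040)
    (1 - y ^+ 2 / 2 + y ^+ 4 / 24 - y ^+ 6 / 720).
  by apply: is_derive_eq; rewrite /GRing.scale /=; field.
apply: (le_of_derive H) => [|y y0]; last exact: cos_ge_taylor6.
by rewrite sin0; lra.
Qed.

(** Expanding [cos (pi / 2)] as the cosine of three times [pi / 6] gives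
    [c * (c ^+ 2 - 3 * s ^+ 2) = 0] with [c] positive, hence [s ^+ 2 = 1 / 4]. *)
Lemma sin_pi6 (R : realType) : sin (pi / 6) = 1 / 2 :> R.
Proof.
have pi0 := pi_gt0 R.
have E : (pi / 6 + pi / 6 + pi / 6 : R) = pi / 2 by field.
have := cos_pihalf R; rewrite -E !cosD sinD.
have s0 : 0 < sin (pi / 6 : R) by apply: sin_gt0_pi; lra.
have c0 : 0 < cos (pi / 6 : R) by apply: cos_gt0_pihalf; lra.
have := cos2Dsin2 (pi / 6 : R).
move: (sin _) (cos _) s0 c0 => s c s0 c0 sc1.
have -> : (c * c - s * s) * c - (s * c + c * s) * s = c * (c ^+ 2 - 3 * s ^+ 2).
  by ring.
move/eqP; rewrite mulf_eq0 (gt_eqF c0) /= => /eqP cs.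
have /eqP : (s - 1 / 2) * (s + 1 / 2) = 0 by lra.
rewrite mulf_eq0 => /orP[|] /eqP; lra.
Qed.

(** Otherwise [355 / 678 <= pi / 6], and monotonicity of the sine gives [sin (355 / 678) <= 1 / 2],
    against the Taylor bound. Such precision serves [pi_num], whose two sides differ by less than
    one millionth. *)
Lemma pi_lt (R : realType) : pi < 355 / 113 :> R.
Proof.
have pi0 := pi_gt0 R.
rewrite ltNge; apply/negP => h.
have : sin (355 / 678) <= sin (pi / 6) :> R.
  rewrite leNgt ltr_sin; first by rewrite -leNgt; lra.
    by rewrite in_itv /=; lra.
  by rewrite in_itv /=; lra.
rewrite sin_pi6; apply/negP; rewrite -ltNge.
have x0 : 0 <= 355 / 678 :> R by lra.
apply: lt_le_trans (sin_ge_taylor7 x0).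
by lra.
Qed.

Lemma pi_num (R : realType) : 2 / 27 * (15 - pi ^+ 2) > 380 / 10 ^+ 3 + 29 / 10 ^+ 6 :> R.
Proof.
have p0 := pi_gt0 R; have p1 := pi_lt R.
have : (pi : R) ^+ 2 <= (355 / 113) ^+ 2.
  rewrite ler_pXn2r ?nnegrE ?(ltW p0) ?(ltW p1) //; lra.
lra.
Qed.

Lemma csc2_double (R : realType) (x : R) : 0 < x < pi / 2 ->
  (sin x ^+ 2)^-1 + (sin (pi / 2 - x) ^+ 2)^-1 = 4 * (sin (x *+ 2) ^+ 2)^-1.
Proof.
move=> /andP[x0 x1].
have s0 : sin x != 0 by apply: lt0r_neq0; apply: sin_gt0_pihalf; rewrite x0.
have c0 : cos x != 0.
  by apply: lt0r_neq0; apply: cos_gt0_pihalf; rewrite x1 andbT; lra.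
have -> : sin (pi / 2 - x) = cos x by rewrite addrC sinDpihalf cosN.
rewrite sin_mulr2n -mulr_natl.
have := cos2Dsin2 x; move: (sin x) (cos x) s0 c0 => s c s0 c0 sc.
have -> : (s ^+ 2)^-1 + (c ^+ 2)^-1 = (c ^+ 2 + s ^+ 2) / (s ^+ 2 * c ^+ 2).
  by field; rewrite s0 c0.
by rewrite sc; field; rewrite s0 c0.
Qed.

(* [sum_csc2] pairs each angle with its complement to [pi / 2]. *)
Definition csc2_angle (R : realType) (n k : nat) : R :=
  k.*2.+1%:R * pi / (2 ^ n.+2)%:R.

(** A finite form of the Basel sum: by [csc2_double], each complementary pair at stage [n + 1]
    yields four times one term of stage [n]. *)
Lemma sum_csc2 (R : realType) (n : nat) :
  \sum_(k < 2 ^ n) (sin (csc2_angle R n k) ^+ 2)^-1 = 2 * 4 ^+ n.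
Proof.
elim: n => [|n IH].
  rewrite expn0 big_ord1 /csc2_angle /= mul1r expr0 mulr1.
  have E : (pi / (2 ^ 2)%:R + pi / (2 ^ 2)%:R : R) = pi / 2 by rewrite natrX; field.
  have := cos_pihalf R; rewrite -E cosD.
  have := cos2Dsin2 (pi / (2 ^ 2)%:R : R).
  move: (sin _) (cos _) => s c h1 h2.
  have -> : s ^+ 2 = 2^-1 by lra.
  by rewrite invrK.
rewrite expnS mul2n -addnn big_split_ord /=.
(* Reversing the upper half of the indices aligns each angle with its complement. *)
rewrite [X in _ + X](reindex_inj rev_ord_inj) /= -big_split /=.
rewrite exprS mulrCA -IH mulr_sumr; apply: eq_bigr => k _.
have pi0 := pi_gt0 R.
have p2 : (2 ^ n.+3)%:R = 2 ^+ n.+3 :> R by rewrite natrX.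
have p20 : 0 < 2 ^+ n.+3 :> R by rewrite exprn_gt0.
have -> : csc2_angle R n k = csc2_angle R n.+1 k *+ 2.
  rewrite /csc2_angle -mulr_natl !natrX !exprS; field.
  by rewrite expf_neq0 ?pnatr_eq0.
have -> : csc2_angle R n.+1 (2 ^ n + (2 ^ n - k.+1))%N = pi / 2 - csc2_angle R n.+1 k.
  have kn := ltn_ord k.
  rewrite /csc2_angle.
  have -> : ((2 ^ n + (2 ^ n - k.+1)).*2.+1 = 2 ^ n.+2 - k.*2.+1)%N.
    by rewrite !expnS; lia.
  rewrite natrB; last by rewrite !expnS; lia.
  rewrite !natrX !exprS; field.
  by rewrite expf_neq0 ?pnatr_eq0.
apply: csc2_double.
rewrite /csc2_angle p2; apply/andP; split; first by rewrite divr_gt0 // mulr_gt0.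
have : k.*2.+1%:R * 2 < 2 ^+ n.+3 :> R.
  by rewrite -p2 -natrM ltr_nat !expnS; have := ltn_ord k; lia.
rewrite ltr_pdivrMr //; move: (2 ^+ n.+3) k.*2.+1%:R => x y; nra.
Qed.

(** Since [sin x <= x], the inverse squares of the angles sum to at most [2 * 4 ^+ n]; multiplying
    by [pi ^+ 2 / (16 * 4 ^+ n)] turns the angles into odd integers. *)
Lemma sum_inv_odd_sqr_le (R : realType) (n : nat) :
  \sum_(k < 2 ^ n) (k.*2.+1%:R ^+ 2)^-1 <= pi ^+ 2 / 8 :> R.
Proof.
have pi0 := pi_gt0 R.
have p0 : 0 < 4 ^+ n :> R by rewrite exprn_gt0.
have E : \sum_(k < 2 ^ n) (k.*2.+1%:R ^+ 2)^-1
    = (\sum_(k < 2 ^ n) (csc2_angle R n k ^+ 2)^-1) * (pi ^+ 2 / (16 * 4 ^+ n)) :> R.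
  rewrite mulr_suml; apply: eq_bigr => k _.
  rewrite /csc2_angle natrX exprMn exprVn -exprM mulnC exprM exprMn !exprS.
  have -> : 2 * (2 * 1) = 4 :> R by ring.
  have k0 : k.*2.+1%:R != 0 :> R by rewrite pnatr_eq0.
  move: k.*2.+1%:R (4 ^+ n) pi k0 (lt0r_neq0 p0) (lt0r_neq0 pi0) => x y z x0 y0 z0.
  by field; rewrite x0 y0 z0.
rewrite E; apply: (@le_trans _ _ ((2 * 4 ^+ n) * (pi ^+ 2 / (16 * 4 ^+ n)))); last first.
  by rewrite le_eqVlt; apply/orP; left; apply/eqP; field; rewrite gt_eqF.
apply: ler_wpM2r; first by rewrite divr_ge0 ?sqr_ge0 // mulr_ge0 ?(ltW p0).
rewrite -(sum_csc2 R); apply: ler_sum => k _.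
have a0 : 0 < csc2_angle R n k by rewrite divr_gt0 ?mulr_gt0 ?ltr0n ?expn_gt0.
have s0 : 0 < sin (csc2_angle R n k).
  apply: sin_gt0_pi; rewrite a0 /= ltr_pdivrMr ?ltr0n ?expn_gt0 //.
  rewrite mulrC ltr_pM2l // ltr_nat !expnS.
  by have := ltn_ord k; lia.
rewrite lef_pV2 ?posrE ?exprn_gt0 // ler_pXn2r ?nnegrE ?(ltW a0) ?(ltW s0) //.
by apply: sin_le_id; exact: ltW.
Qed.

(** The even terms of the sum up to [2m] are a quarter of the sum up to [m], so a strong induction
    closes because [pi^2 / 8 + (pi^2 / 6) / 4 = pi^2 / 6]. *)
Lemma sum_inv_sqr_le (R : realType) (n : nat) :
  \sum_(0 <= k < n) (k.+1%:R ^+ 2)^-1 <= pi ^+ 2 / 6 :> R.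
Proof.
have pos k : 0 <= (k.+1%:R ^+ 2)^-1 :> R by rewrite invr_ge0 exprn_ge0.
have odd m : \sum_(0 <= k < m) (k.*2.+1%:R ^+ 2)^-1 <= pi ^+ 2 / 8 :> R.
  apply: le_trans (sum_inv_odd_sqr_le R m).
  rewrite -(big_mkord xpredT (fun k => (k.*2.+1%:R ^+ 2)^-1)).
  rewrite [leRHS](big_cat_nat (n := m)) //=; last by rewrite ltnW // ltn_expl.
  by rewrite lerDl sumr_ge0.
have rec m : \sum_(0 <= k < m.*2) (k.+1%:R ^+ 2)^-1
   = \sum_(0 <= k < m) (k.*2.+1%:R ^+ 2)^-1 + (\sum_(0 <= k < m) (k.+1%:R ^+ 2)^-1) / 4 :> R.
  elim: m => [|m IH]; first by rewrite !big_geq // add0r mul0r.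
  rewrite doubleS !big_nat_recr //= IH.
  have -> : m.*2.+2%:R = 2 * m.+1%:R :> R by rewrite -natrM mul2n.
  have m0 : m.+1%:R != 0 :> R by rewrite pnatr_eq0.
  have m1 : m.*2.+1%:R != 0 :> R by rewrite pnatr_eq0.
  move: m.+1%:R m.*2.+1%:R m0 m1 => x y x0 y0.
  by field; rewrite x0 y0.
have [m] := ubnP n; elim: m n => // m IH n nm.
case: n nm => [|[|n]] nm; first by rewrite big_geq // divr_ge0 ?sqr_ge0.
  by have := odd 1%N; rewrite !big_nat1 expr1n invr1; lra.
have le : (n.+2 <= (uphalf n.+2).*2)%N by lia.
apply: (@le_trans _ _ (\sum_(0 <= k < (uphalf n.+2).*2) (k.+1%:R ^+ 2)^-1)).
  by rewrite [leRHS](big_cat_nat (n := n.+2)) //= lerDl sumr_ge0.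
rewrite rec; have := odd (uphalf n.+2); have : (uphalf n.+2 < m)%N by lia.
by move/IH; lra.
Qed.

(** With [a = 1/j] and [b = 1/(j+1)] one has [a * b = a - b], so [(a - b)^3 = a^3 - b^3 - 3 * (a^2 +
    b^2) + 6 * (a - b)]. All but the squares telescopes, and the upper bound on the sum of inverse
    squares gives the lower bound here. *)
Lemma sum_inv_pronic_cube_ge (R : realType) (n : nat) : (0 < n)%N ->
  10 - pi ^+ 2 - 10 / n%:R <= \sum_(1 <= j < n.+1) ((j * j.+1)%:R ^+ 3)^-1 :> R.
Proof.
move=> n0.
have E : \sum_(1 <= j < n.+1) ((j * j.+1)%:R ^+ 3)^-1
   = 10 - (n.+1%:R ^+ 3)^-1 - 3 * (n.+1%:R ^+ 2)^-1 - 6 * n.+1%:R^-1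
     - 6 * \sum_(0 <= k < n) (k.+1%:R ^+ 2)^-1 :> R.
  elim: n {n0} => [|n IH]; first by rewrite !big_geq // !expr1n; lra.
  rewrite big_nat_recr //= IH [in RHS]big_nat_recr //= natrM -[n.+2%:R]natr1.
  have x0 : 0 < n.+1%:R :> R by rewrite ltr0n.
  move: n.+1%:R x0 => x x0.
  by field; apply/andP; split; apply: lt0r_neq0; lra.
rewrite E; have := sum_inv_sqr_le R n.
have i0 : 0 <= n.+1%:R^-1 :> R by rewrite invr_ge0.
have i1 : n.+1%:R^-1 <= 1 :> R by rewrite invf_le1 ?ltr0n // ler1n.
have i2 : n.+1%:R^-1 <= n%:R^-1 :> R by rewrite lef_pV2 ?posrE ?ltr0n // ler_nat.
rewrite -!exprVn; move: n.+1%:R^-1 n%:R^-1 i0 i1 i2 => x y x0 x1 xy.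
have x2 : x ^+ 2 <= x by rewrite expr2; nra.
have x3 : x ^+ 3 <= x ^+ 2 by rewrite [x ^+ 3]exprS ler_piMl ?sqr_ge0.
lra.
Qed.

(** * Summation over the windows *)

(* The antiderivative of [y * (m - T * y) ^+ 2 / 2] vanishing at 0. *)
Definition layer_prim (R : realFieldType) (m T y : R) : R :=
  (m ^+ 2 * y ^+ 2 / 2 - 2 * m * T * y ^+ 3 / 3 + T ^+ 2 * y ^+ 4 / 4) / 2.

(** The left side is an integral over [[x, x + d]]. There [m - T * y] is at most its value at [x];
    writing [y = x + (y - x)], the part with [x] gives the first term and the part with [y - x] at
    most [m ^+ 2], because [d <= 2]. *)
Lemma layer_prim_step (R : realFieldType) (m T x d : R) :
  0 <= x -> 0 <= d -> d <= 2 -> 0 < T -> T * (x + d) <= m ->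
  layer_prim m T (x + d) - layer_prim m T x <= x * (m - T * x) ^+ 2 + m ^+ 2.
Proof.
move=> x0 d0 d2 T0 xdm.
pose z := m - T * x; pose w := T * d.
have w0 : 0 <= w by rewrite mulr_ge0 // ltW.
have wz : w <= z by rewrite /w /z; lra.
have -> : layer_prim m T (x + d) - layer_prim m T x = (x * d * (z ^+ 2 - z * w + w ^+ 2 / 3)
    + d ^+ 2 * (z ^+ 2 / 2 - 2 / 3 * z * w + w ^+ 2 / 4)) / 2.
  by rewrite /layer_prim /z /w; field.
have z0 : 0 <= z by apply: le_trans wz.
have z2 : z ^+ 2 <= m ^+ 2.
  have Tx : 0 <= T * x by rewrite mulr_ge0 // ltW.
  have zm : z <= m by rewrite /z gerBl.
  by rewrite ler_pXn2r ?nnegrE // (le_trans z0).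
have ww : w ^+ 2 <= z * w by rewrite expr2 ler_wpM2r.
have zz : 0 <= z ^+ 2 by exact: sqr_ge0.
have zw0 : 0 <= z * w by rewrite mulr_ge0.
have h1 : x * d * (z ^+ 2 - z * w + w ^+ 2 / 3) <= x * 2 * z ^+ 2.
  apply: ler_pM; rewrite ?mulr_ge0 //; first by nra.
    by rewrite ler_wpM2l.
  lra.
have h2 : d ^+ 2 * (z ^+ 2 / 2 - 2 / 3 * z * w + w ^+ 2 / 4) <= 4 * (z ^+ 2 / 2).
  have d4 : d ^+ 2 <= 4 by rewrite expr2; nra.
  apply: (@le_trans _ _ (d ^+ 2 * (z ^+ 2 / 2))).
    by apply: ler_wpM2l; [exact: sqr_ge0 | lra].
  by apply: ler_wpM2r; [lra | exact: d4].
rewrite -/z; lra.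
Qed.

(** Comparison of a sum of mesh 2 with the integral over [[0, m / T]], whose value is
    [m ^+ 4 / (24 * T ^+ 2)]. The [h] steps of the grid and the initial interval [[0, e]] each cost
    at most [m ^+ 2]. *)
Lemma layer_sum_ge (R : realFieldType) (m T e : R) (h : nat) :
  0 <= m -> 0 < T -> 0 <= e -> e <= 2 -> m <= T * (h.*2%:R + e) ->
  m ^+ 4 / (24 * T ^+ 2) - h.+1%:R * m ^+ 2
    <= \sum_(i < h) (i.*2%:R + e) * Num.max 0 (m - T * (i.*2%:R + e)) ^+ 2.
Proof.
move=> m0 T0 e0 e2 mh.
(* Stopping at [m / T] matches the truncation of the summand by [Num.max 0]. *)
pose Gc y := layer_prim m T (Num.min y (m / T)).
have mT0 : 0 <= m / T by rewrite divr_ge0 // ltW.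
have step x d : 0 <= x -> 0 <= d -> d <= 2 ->
    Gc (x + d) - Gc x <= x * Num.max 0 (m - T * x) ^+ 2 + m ^+ 2.
  move=> x0 d0 d2; rewrite /Gc.
  have [Txm|Txm] := leP (m / T) x.
    rewrite min_r; last by rewrite (le_trans Txm) // lerDl.
    by rewrite subrr addr_ge0 ?sqr_ge0 // mulr_ge0 ?sqr_ge0.
  have Txm' : T * x < m by rewrite mulrC -ltr_pdivlMr.
  have [h1|h1] := leP (x + d) (m / T).
    rewrite max_r ?subr_ge0 ?(ltW Txm') //.
    by apply: layer_prim_step => //; rewrite mulrC -ler_pdivlMr.
  rewrite max_r ?subr_ge0 ?(ltW Txm') //.
  have -> : m / T = x + (m / T - x) by rewrite addrC subrK.
  apply: layer_prim_step => //; try lra.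
  by rewrite addrC subrK mulrC divfK // gt_eqF.
have Gtop : Gc (h.*2%:R + e) = m ^+ 4 / (24 * T ^+ 2).
  rewrite /Gc min_r; last by rewrite ler_pdivrMr // mulrC.
  by rewrite /layer_prim; field; rewrite gt_eqF.
have G00 : Gc 0 = 0 by rewrite /Gc min_l // /layer_prim !expr0n /=; ring.
have main k : Gc (k.*2%:R + e) - k.+1%:R * m ^+ 2
    <= \sum_(i < k) (i.*2%:R + e) * Num.max 0 (m - T * (i.*2%:R + e)) ^+ 2.
  elim: k => [|k IH].
    have := step 0 e (lexx _) e0 e2; rewrite big_ord0 G00 /= !add0r; lra.
  rewrite big_ord_recr /=.
  have := step (k.*2%:R + e) 2 (addr_ge0 (ler0n _ _) e0) (ler0n _ _) (lexx _).
  have -> : k.+1.*2%:R + e = k.*2%:R + e + 2 by rewrite doubleS -addn2 natrD; ring.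
  rewrite -[k.+2%:R]natr1; lra.
by rewrite -Gtop.
Qed.

(** Take the largest admissible number [l] of cuts: [Num.max 0] kills exactly the terms beyond it.
    The range of [j] then no longer depends on [M], so the sum over windows can be exchanged with
    the sum over [j]. *)
Lemma arcs_le_max (R : realFieldType) (E : rel nat) (M m : nat) :
  (forall i j, E i j -> (i < j)%N) -> near_balanced E M m -> (0 < M)%N ->
  (arcs E m)%:R <= m%:R ^+ 2 / 2 + m%:R
    - \sum_(1 <= j < m.+1) Num.max 0 (m%:R - (j * j.+1)%:R / 2 * M%:R) ^+ 2
        / (2 * (j * j.+1)%:R) :> R.
Proof.
move=> El bal M0.
pose P l := (l * l.+1 * M <= m.*2)%N.
have lm l : P l -> (l <= m)%N.
  rewrite /P => Pl; have : (l * l.+1 <= m.*2)%N.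
    by apply: leq_trans Pl; rewrite leq_pmulr.
  by case: l {Pl} => // l; clear; nia.
have [l Pl lmax] := ex_maxnP (ex_intro P 0%N (leq0n _)) lm.
apply: (le_trans (arcs_le R El bal Pl)).
have lmR : l%:R <= m%:R :> R by rewrite ler_nat lm.
rewrite (big_cat_nat (n := l.+1)) ?ltnS ?lm //=.
rewrite [X in _ - (_ + X)]big_nat [X in _ - (_ + X)]big1; last first.
  move=> j /andP[lj _]; rewrite max_l ?expr0n ?mul0r //.
  have : ~~ P j by apply/negP => /lmax; rewrite leqNgt lj.
  rewrite -ltnNge => /ltnW; rewrite -(ler_nat R) natrM -muln2 natrM; lra.
rewrite addr0 /arc_bound.
have -> : \sum_(1 <= j < l.+1) Num.max 0 (m%:R - (j * j.+1)%:R / 2 * M%:R) ^+ 2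
        / (2 * (j * j.+1)%:R)
   = \sum_(1 <= j < l.+1) (m%:R - (j * j.+1)%:R / 2 * M%:R) ^+ 2
        / (2 * (j * j.+1)%:R) :> R.
  apply: eq_big_nat => j /andP[_ jl]; rewrite max_r //.
  have : (j * j.+1 * M <= m.*2)%N.
    by apply: leq_trans Pl; rewrite leq_mul2r leq_mul ?orbT // ltnW.
  rewrite -(ler_nat R) natrM -muln2 natrM; lra.
lra.
Qed.

Lemma sum_inv_pronic_le (R : realFieldType) (n : nat) :
  \sum_(1 <= j < n.+1) ((j * j.+1)%:R)^-1 <= 1 :> R.
Proof.
suff -> : \sum_(1 <= j < n.+1) ((j * j.+1)%:R)^-1 = 1 - n.+1%:R^-1 :> R.
  by rewrite gerBl invr_ge0.
elim: n => [|n IH]; first by rewrite big_geq // invr1 subrr.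
rewrite big_nat_recr //= IH natrM -[n.+2%:R]natr1.
have x0 : 0 < n.+1%:R :> R by rewrite ltr0n.
move: n.+1%:R x0 => x x0; field.
by apply/andP; split; apply: lt0r_neq0; lra.
Qed.

(** The weights [M] sum to about [(3m/2)^2], which with [m^2 / 2] gives [9 / 8]. For fixed [j],
    [layer_sum_ge] with [T = j(j+1)/2] gives [m^4 / (12 * (j(j+1))^3)], and [sum_inv_pronic_cube_ge]
    sums these. *)
Lemma weighted_layers_le (R : realType) (m h o : nat) (a : nat -> R) :
  (0 < m)%N -> (h.*2 + o = 3 * m - 2)%N -> (o <= 1)%N ->
  (forall i, (i < h)%N -> a i <= m%:R ^+ 2 / 2 + m%:R
    - \sum_(1 <= j < m.+1) Num.max 0 (m%:R - (j * j.+1)%:R / 2 * (i.*2 + o.+1)%:R) ^+ 2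
        / (2 * (j * j.+1)%:R)) ->
  \sum_(i < h) (i.*2 + o.+1)%:R * a i
    <= (9 / 8 - (10 - pi ^+ 2) / 12) * m%:R ^+ 4 + 4 * m%:R ^+ 3.
Proof.
move=> m0 hE o1 ale.
set x : R := m%:R.
have x1 : 1 <= x by rewrite ler1n.
pose e : R := o.+1%:R.
have e0 : 0 <= e by [].
have e2 : e <= 2 by rewrite ler_nat ltnS.
have hoE : 2 * h%:R + e = 3 * x - 1.
  have E : (h.*2 + o.+1 + 1)%:R = (3 * m)%:R :> R by congr (_%:R); lia.
  by move: E; rewrite natrM -/x !natrD -/e -mul2n natrM; lra.
have Mi i : (i.*2 + o.+1)%:R = i.*2%:R + e :> R by rewrite natrD.
have sumM : \sum_(i < h) (i.*2 + o.+1)%:R <= 9 / 4 * x ^+ 2 :> R.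
  have -> : \sum_(i < h) (i.*2 + o.+1)%:R = h%:R * (h%:R - 1 + e) :> R.
    elim: h {hE ale hoE} => [|k IH]; first by rewrite big_ord0 mul0r.
    by rewrite big_ord_recr /= IH Mi -mul2n natrM -[k.+1%:R]natr1; ring.
  have h0 : 0 <= h%:R :> R by [].
  nra.
pose B i := \sum_(1 <= j < m.+1) Num.max 0 (x - (j * j.+1)%:R / 2 * (i.*2 + o.+1)%:R) ^+ 2
        / (2 * (j * j.+1)%:R).
have step1 : \sum_(i < h) (i.*2 + o.+1)%:R * a i
   <= (\sum_(i < h) (i.*2 + o.+1)%:R) * (x ^+ 2 / 2 + x)
      - \sum_(i < h) (i.*2 + o.+1)%:R * B i.
  rewrite mulr_suml -sumrB; apply: ler_sum => i _.
  by rewrite -mulrBr ler_wpM2l // ale.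
have step2 : \sum_(i < h) (i.*2 + o.+1)%:R * B i
   = \sum_(1 <= j < m.+1) (2 * (j * j.+1)%:R)^-1 *
      \sum_(i < h) (i.*2%:R + e) * Num.max 0 (x - (j * j.+1)%:R / 2 * (i.*2%:R + e)) ^+ 2.
  rewrite /B; under eq_bigr do rewrite mulr_sumr.
  rewrite exchange_big /=; apply: eq_bigr => j _.
  by rewrite mulr_sumr; apply: eq_bigr => i _; rewrite Mi; ring.
have step3 : \sum_(1 <= j < m.+1) (((j * j.+1)%:R ^+ 3)^-1 * (x ^+ 4 / 12)
      - ((j * j.+1)%:R)^-1 * (3 / 4 * x ^+ 3))
   <= \sum_(i < h) (i.*2 + o.+1)%:R * B i.
  rewrite step2 big_nat [leRHS]big_nat; apply: ler_sum => j /andP[j0 _].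
  have J1 : 1 <= (j * j.+1)%:R / 2 :> R.
    by rewrite ler_pdivlMr // mul1r ler_nat; case: j j0 => // j _; rewrite mulSn; lia.
  have T0 : 0 < (j * j.+1)%:R / 2 :> R by apply: lt_le_trans J1.
  have xh : x <= (j * j.+1)%:R / 2 * (h.*2%:R + e).
    have -> : h.*2%:R = 2 * h%:R :> R by rewrite -mul2n natrM.
    rewrite hoE; apply: (@le_trans _ _ (1 * (3 * x - 1))); first by lra.
    by apply: ler_wpM2r => //; lra.
  have := layer_sum_ge (le_trans ler01 x1) T0 e0 e2 xh.
  have hx : h.+1%:R * x ^+ 2 <= 3 / 2 * x ^+ 3.
    rewrite [x ^+ 3]exprS [leRHS]mulrA; apply: ler_wpM2r; first exact: sqr_ge0.
    have : 0 < e by rewrite ltr0n.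
    have : 1 <= e by rewrite ler1n.
    rewrite -[h.+1%:R]natr1; lra.
  move: (\sum_(i < h) _) => S.
  have J0 : 0 < (j * j.+1)%:R :> R by lra.
  move: ((j * j.+1)%:R) J0 {J1 T0 xh} => J J0 SJ.
  have -> : (J ^+ 3)^-1 * (x ^+ 4 / 12) - J^-1 * (3 / 4 * x ^+ 3)
     = (2 * J)^-1 * (x ^+ 4 / (24 * (J / 2) ^+ 2) - 3 / 2 * x ^+ 3).
    by field; rewrite gt_eqF.
  apply: ler_wpM2l; first by rewrite invr_ge0 mulr_ge0 // ltW.
  lra.
have step4 : (10 - pi ^+ 2) / 12 * x ^+ 4 - 10 / 12 * x ^+ 3 - 3 / 4 * x ^+ 3
   <= \sum_(i < h) (i.*2 + o.+1)%:R * B i.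
  apply: le_trans step3.
  rewrite sumrB -!mulr_suml.
  have x4 : 0 <= x ^+ 4 / 12 by rewrite divr_ge0 // exprn_ge0 // ; lra.
  have x3 : 0 <= 3 / 4 * x ^+ 3 by rewrite mulr_ge0 ?exprn_ge0 //; lra.
  have := ler_wpM2r x4 (sum_inv_pronic_cube_ge R m0).
  have := ler_wpM2r x3 (sum_inv_pronic_le R m).
  have -> : (10 - pi ^+ 2 - 10 / m%:R) * (x ^+ 4 / 12)
     = (10 - pi ^+ 2) / 12 * x ^+ 4 - 10 / 12 * x ^+ 3.
    rewrite -/x; move: pi => p; field; apply: lt0r_neq0; lra.
  lra.
have xx : 0 <= x ^+ 2 / 2 + x by have := sqr_ge0 x; lra.
have step5 := ler_wpM2r xx sumM.
have E5 : 9 / 4 * x ^+ 2 * (x ^+ 2 / 2 + x) = 9 / 8 * x ^+ 4 + 9 / 4 * x ^+ 3 by field.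
have x3 : 0 <= x ^+ 3 by rewrite exprn_ge0 //; lra.
move: step1 step4 step5; rewrite E5.
move: (\sum_(i < h) _) (\sum_(i < h) _) (\sum_(i < h) _) => S1 S2 S3.
move: (x ^+ 3) (x ^+ 4) x3 => x3 x4 ? *.
lra.
Qed.

(** Closed form of the sum of [j * (N - j)] over [j < k]: a potential whose increments are pair
    weights. *)
Definition cumul (R : realFieldType) (N : R) (k : nat) : R :=
  k%:R * (k%:R - 1) / 2 * N - (k%:R - 1) * k%:R * (2 * k%:R - 1) / 6.

Lemma cumulS (R : realFieldType) (N : R) (k : nat) :
  cumul N k.+1 - cumul N k = k%:R * (N - k%:R).
Proof. by rewrite /cumul -[k.+1%:R]natr1; field. Qed.

Lemma sum_cumul_le (R : realFieldType) (m : nat) : (0 < m)%N ->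
  \sum_(i < m) (cumul ((3 * m - 2)%:R : R) (3 * m - 1 - i)
                - cumul ((3 * m - 2)%:R) i)
    <= 11 / 3 * m%:R ^+ 4 + 10 * m%:R ^+ 3.
Proof.
move=> m0; set x : R := m%:R; have x1 : 1 <= x by rewrite ler1n.
set N : R := (3 * m - 2)%:R.
have NE : N = 3 * x - 2 by rewrite /N natrB ?natrM //; lia.
have E k : (k <= m)%N -> \sum_(i < k) (cumul N (3 * m - 1 - i) - cumul N i)
   = k%:R * ((N + 1) * N * (N - 1) / 6)
     - 2 * (N * k%:R * (k%:R - 1) * (k%:R - 2) / 6 - k%:R * (k%:R - 1) ^+ 2 * (k%:R - 2) / 12).
  elim: k => [|k IH] km; first by rewrite big_ord0; ring.
  rewrite big_ord_recr /= IH; last exact: ltnW.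
  (* The weight [j * (N - j)] is symmetric under [j -> N - j], and the full sum
     [(N + 1) * N * (N - 1) / 6] is reached at [N + 1 = 3m - 1]. *)
  have -> : cumul N (3 * m - 1 - k) = (N + 1) * N * (N - 1) / 6 - cumul N k.
    rewrite /cumul natrB; last by lia.
    by rewrite natrB ?natrM; [rewrite NE -/x; field | lia].
  by rewrite /cumul -[k.+1%:R]natr1; field.
rewrite E // -/x NE.
have x2 : x <= x ^+ 2 by rewrite expr2; nra.
have x3 : x ^+ 2 <= x ^+ 3 by rewrite [x ^+ 3]exprS ler_peMl ?sqr_ge0.
lra.
Qed.

(** * Pairs inside and outside an extreme class *)

Definition orient (R : realDomainType) (T : Type) (X Y : T -> R) (p q r : T) : R :=
  (X q - X p) * (Y r - Y p) - (Y q - Y p) * (X r - X p).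

Definition generic (R : realDomainType) (T : eqType) (X Y : T -> R) : Prop :=
  forall p q r, p != q -> q != r -> p != r -> orient X Y p q r != 0.

(* Dually, [p] is the line [s |-> s * X p + Y p]; [below X Y p q] is the number
   of lines passing strictly below the crossing of [p] and [q]. *)
Definition below (R : realDomainType) (T : finType) (X Y : T -> R) (p q : T) : nat :=
  #|[pred r | orient X Y p q r * (X q - X p) < 0]|.

Lemma below_sym (R : realDomainType) (T : finType) (X Y : T -> R) (p q : T) :
  below X Y p q = below X Y q p.
Proof.
apply: eq_card => r; rewrite !inE; congr (_ < 0).
by rewrite /orient; ring.
Qed.

Lemma below_le (R : realDomainType) (T : finType) (X Y : T -> R) (p q : T) :
  p != q -> (below X Y p q <= #|T| - 2)%N.
Proof.
move=> pq; have -> : (#|T| - 2 = #|predC (pred2 p q)|)%N.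
  by rewrite -(cardC (pred2 p q)) card2 pq addKn.
rewrite /below; apply/subset_leq_card/fintype.subsetP => r; rewrite !inE negb_or => H.
by apply/andP; split; apply/eqP => rE; move: H; rewrite rE /orient ltNge; apply/negP/negPn;
  rewrite le_eqVlt; apply/orP; left; apply/eqP; ring.
Qed.

Definition crossing_abscissa (R : realFieldType) (T : Type) (X Y : T -> R) (p q : T) : R :=
  - (Y q - Y p) / (X q - X p).

Lemma count_enum (T : finType) (A a : pred T) : count a (enum A) = #|[predI a & A]|.
Proof. by rewrite cardE /enum_mem size_filter count_filter. Qed.

Lemma orient_crossing (R : realFieldType) (T : finType) (X Y : T -> R) (p q r : T) :
  injective X -> q != p -> r != p ->
  orient X Y p q r * (X q - X p) = (X q - X p) ^+ 2 * ((X r - X p)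
    * (crossing_abscissa X Y p q - crossing_abscissa X Y p r)).
Proof.
move=> Xi qp rp; rewrite /orient /crossing_abscissa.
have q0 : X q - X p != 0 by rewrite subr_eq0 (inj_eq Xi).
have r0 : X r - X p != 0 by rewrite subr_eq0 (inj_eq Xi).
by field; rewrite q0 r0.
Qed.

(** Follow the line of [p] from left to right. A line of smaller slope starts above it and ends
    below, so it counts once its crossing is past; a line of larger slope counts until its crossing.
    These are the two counts in [level]. *)
Lemma below_level (R : realFieldType) (T : finType) (X Y : T -> R) (p q : T) :
  injective X -> q != p ->
  below X Y p q = level (crossing_abscissa X Y p) (fun r => X r < X p) (enum (predC1 p)) q.
Proof.
move=> Xi qp; rewrite /level -count_predUI.
rewrite [X in (_ = _ + X)%N](eq_count (a2 := pred0)) ?count_pred0 ?addn0; last first.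
  by move=> r /=; case: (X r < X p); rewrite /= ?andbF.
rewrite count_enum; apply: eq_card => r; rewrite !inE /=.
have [->|rp] := eqVneq r p.
  by rewrite andbF /orient !subrr !mulr0 subrr mul0r ltxx.
rewrite andbT orient_crossing // pmulr_rlt0; last first.
  by rewrite exprn_even_gt0 //= subr_eq0 (inj_eq Xi).
have [rl|rg] := ltP (X r) (X p); rewrite /= ?orbF.
  by rewrite nmulr_rlt0 ?subr_lt0 // subr_gt0.
rewrite pmulr_rlt0 ?subr_lt0 // subr_gt0 lt_neqAle rg andbT.
by rewrite (inj_eq Xi) eq_sym.
Qed.

(** Two equal abscissas would make three dual lines concurrent, that is, three points collinear. *)
Lemma crossing_abscissa_inj (R : realFieldType) (T : finType) (X Y : T -> R) (p : T) :
  injective X -> generic X Y -> {in enum (predC1 p) &, injective (crossing_abscissa X Y p)}.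
Proof.
move=> Xi gen q r; rewrite !mem_enum !inE => qp rp qr.
apply/eqP/negPn/negP => nqr.
have pq : p != q by rewrite eq_sym.
have pr : p != r by rewrite eq_sym.
have /negP := gen p q r pq nqr pr; apply.
have := orient_crossing Y Xi qp rp; rewrite qr subrr !mulr0 => /eqP.
by rewrite mulf_eq0 => /orP[//|]; rewrite subr_eq0 (inj_eq Xi) (negbTE qp).
Qed.

Lemma walk_below (R : realFieldType) (V : zmodType) (T : finType) (X Y : T -> R)
    (G : nat -> V) (p : T) :
  injective X -> generic X Y ->
  \sum_(q | q != p) (if X q < X p then G (below X Y p q).+1 - G (below X Y p q)
                     else G (below X Y p q) - G (below X Y p q).+1)
    = G #|[pred q | X q < X p]| - G #|[pred q | X p < X q]|.
Proof.
move=> Xi gen.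
have := @walk _ _ _ _ (fun r => X r < X p) G _ (enum_uniq (predC1 p))
  (crossing_abscissa_inj Xi gen).
rewrite big_enum /= !count_enum => H.
transitivity (G #|[predI (fun r => X r < X p) & predC1 p]|
   - G #|[predI [predC (fun r => X r < X p)] & predC1 p]|).
  by rewrite -H; apply: eq_bigr => q qp; rewrite -below_level.
congr (G _ - G _); apply: eq_card => q; rewrite !inE.
  by have [->|_] := eqVneq q p; rewrite ?ltxx ?andbT.
rewrite -leNgt lt_neqAle (inj_eq Xi) eq_sym andbC.
by [].
Qed.

Lemma card_lt_gt (R : realDomainType) (T : finType) (X : T -> R) (p : T) :
  injective X ->
  #|[pred q | X q < X p]| = (#|T| - 1 - #|[pred q | (X p < X q)%R]|)%N.
Proof.
move=> Xi; have := cardID [pred q | X q < X p] (predC1 p); rewrite cardC1 -subn1 => <-.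
have -> : #|[predI predC1 p & [pred q | X q < X p]]| = #|[pred q | X q < X p]|.
  by apply: eq_card => q; rewrite !inE; have [->|] := eqVneq q p; rewrite ?ltxx.
have -> : #|[predD predC1 p & [pred q | X q < X p]]| = #|[pred q | X p < X q]|.
  by apply: eq_card => q; rewrite !inE -leNgt lt_neqAle (inj_eq Xi) eq_sym andbC.
by rewrite addnK.
Qed.

Lemma decreasing_enum (R : realDomainType) (T : finType) (X : T -> R) (A : {set T}) (x0 : T) :
  injective X ->
  exists s : seq T, [/\ perm_eq s (enum A), uniq s, size s = #|A| &
    forall i j, (i < j)%N -> (j < size s)%N -> X (nth x0 s j) < X (nth x0 s i)].
Proof.
move=> Xi; pose le (a b : T) := X b <= X a.
exists (sort le (enum A)).
have us : uniq (sort le (enum A)) by rewrite sort_uniq enum_uniq.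
split=> //.
- exact/permPl/perm_sort.
- by rewrite size_sort -cardE.
move=> i j ij js; have is' := ltn_trans ij js.
have : le (nth x0 (sort le (enum A)) i) (nth x0 (sort le (enum A)) j).
  apply: sorted_ltn_nth => //; first by move=> x y z /= xy yz; apply: le_trans yz xy.
  by apply: sort_sorted => x y; apply: le_total.
rewrite /le le_eqVlt => /orP[/eqP/Xi/eqP|//].
by rewrite nth_uniq // gtn_eqF.
Qed.

(** As [A] is extreme, only elements of [A] can exceed its [i]-th largest one. *)
Lemma card_above_nth (R : realDomainType) (T : finType) (X : T -> R) (A : {set T})
    (x0 : T) (s : seq T) (i : nat) :
  perm_eq s (enum A) -> uniq s ->
  (forall i j, (i < j)%N -> (j < size s)%N -> X (nth x0 s j) < X (nth x0 s i)) ->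
  (forall a q, a \in A -> q \notin A -> X q < X a) -> (i < size s)%N ->
  #|[pred q | X (nth x0 s i) < X q]| = i.
Proof.
move=> ps us dec top il.
have sA q : (q \in s) = (q \in A) by rewrite (perm_mem ps) mem_enum.
transitivity #|take i s|; last first.
  by rewrite (card_uniqP _) ?take_uniq // size_take il.
apply: eq_card => q; rewrite !inE.
have [qs|qs] := boolP (q \in s); last first.
  rewrite (contraNF (@mem_take _ _ _ _) qs); apply/negbTE; rewrite -leNgt ltW //.
  by apply: top; rewrite -sA // mem_nth.
rewrite in_take //; rewrite -{1}(nth_index x0 qs).
have ql : (index q s < size s)%N by rewrite index_mem.
case: (ltngtP (index q s) i) => [h|h|->]; last by rewrite ltxx.
  by rewrite dec.
by apply/negbTE; rewrite -leNgt ltW // dec.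
Qed.

Definition pair_weight (R : realFieldType) (T : finType) (X Y : T -> R) (p q : T) : R :=
  (below X Y p q)%:R * ((#|T| - 2)%:R - (below X Y p q)%:R).

(** Apply [walk_below] to the potential [cumul] at each [a] in [A]. Steps at points outside [A] all
    go up, so they carry the weight with a plus sign; the end ranks are known because [A] is
    extreme. *)
Lemma sum_outer (R : realFieldType) (T : finType) (X Y : T -> R) (A : {set T}) :
  injective X -> generic X Y -> (forall a q, a \in A -> q \notin A -> X q < X a) ->
  \sum_(a in A) \sum_(q | q \notin A) pair_weight X Y a q
   = \sum_(i < #|A|) (cumul ((#|T| - 2)%:R : R) (#|T| - 1 - i)%N - cumul ((#|T| - 2)%:R) i).
Proof.
move=> Xi gen top; pose N : R := (#|T| - 2)%:R.
have [A0|[x0 _]] := set_0Vmem A; first by rewrite A0 big_set0 cards0 big_ord0.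
have [s [ps us sz dec]] := decreasing_enum A x0 Xi.
pose sg a q := if X q < X a then pair_weight X Y a q else - pair_weight X Y a q.
(* [sg] is antisymmetric, so exchanging the two points shows that this sum equals its opposite. *)
have inner0 : \sum_(a in A) \sum_(q in A | q != a) sg a q = 0.
  set S := \sum_(a in A) _.
  have : S = - S.
    rewrite {1}/S (exchange_big_dep (fun q => q \in A)) /=; last by move=> a q _ /andP[].
    rewrite /S -sumrN; apply: eq_bigr => a aA; rewrite -sumrN.
    apply: eq_big => [q|q /andP[qA qa]].
      by apply/and3P/andP => [[qA _ aq]|[qA qa]]; split=> //; rewrite eq_sym.
    rewrite /sg /pair_weight below_sym; case: ltgtP => [|_|/Xi qE].
    - by rewrite opprK.
    - by [].
    - by move: qa => /andP[_]; rewrite qE eqxx.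
  by move/eqP; rewrite -addr_eq0 -mulr2n mulrn_eq0 /= => /eqP.
transitivity (\sum_(a in A) \sum_(q | q != a) sg a q).
  have split a : a \in A -> \sum_(q | q != a) sg a q
      = \sum_(q in A | q != a) sg a q + \sum_(q | q \notin A) pair_weight X Y a q.
    move=> aA; rewrite (bigID (mem A)) /=; congr (_ + _).
      by apply: eq_bigl => q; rewrite andbC.
    apply: eq_big => [q|q /andP[_ qA]]; last by rewrite /sg top.
    by have [->|] := eqVneq q a; rewrite ?aA.
  by rewrite (eq_bigr _ split) big_split /= inner0 add0r.
transitivity (\sum_(a in A) (cumul N #|[pred q | X q < X a]| - cumul N #|[pred q | X a < X q]|)).
  apply: eq_bigr => a aA; rewrite -(walk_below (Y := Y)) //.
  apply: eq_bigr => q _; rewrite cumulS -[cumul _ _ - cumul _ _.+1]opprB cumulS.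
  by [].
rewrite -big_enum -(perm_big _ ps) /= (big_nth x0) sz big_mkord.
apply: eq_bigr => i _; rewrite card_lt_gt //.
by rewrite (card_above_nth ps us dec top) // sz.
Qed.

(* [r * (h.*2 + o - r)] is a sum of indicators of nested windows: the [l]-th one
   is [h - l, h + o + l], with weight its own width (see [sum_central]). *)
Definition central (h o l r : nat) : bool := (h <= r + l)%N && (r <= h + o + l)%N.

(** The number of ranks below [k] in the [l]-th window: the potential whose increments are the
    indicator [central]. *)
Definition central_count (h o l k : nat) : nat :=
  (minn k (h + o + l).+1 - minn k (h - l))%N.

Lemma central_countS (R : realDomainType) (h o l k : nat) :
  (central_count h o l k.+1)%:R - (central_count h o l k)%:R = (central h o l k)%:R :> R.
Proof.
have -> : central_count h o l k.+1 = (central h o l k + central_count h o l k)%N.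
  by rewrite /central_count /central; lia.
by rewrite natrD addrK.
Qed.

Lemma sum_central (R : realFieldType) (h o r : nat) : (o <= 1)%N -> (r <= h.*2 + o)%N ->
  \sum_(l < h) (l.*2 + o.+1)%:R * (central h o l r)%:R
    = r%:R * ((h.*2 + o)%:R - r%:R) :> R.
Proof.
move=> o1 rN.
(* The distance from [r] to the middle [[h, h + o]]: the windows containing [r] are those with
   [l >= s]. *)
pose s := maxn (h - r) (r - h - o).
have sh : (s <= h)%N by rewrite /s; lia.
have E k : (s <= k)%N -> \sum_(s <= l < k) (l.*2 + o.+1)%:R
    = (k%:R - s%:R) * (k%:R + s%:R + o%:R) :> R.
  elim: k => [|k IH] sk.
    have -> : s = 0%N by lia.
    by rewrite big_geq // subrr mul0r.
  move: sk; rewrite leq_eqVlt => /orP[/eqP <-|sk].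
    by rewrite big_geq // subrr mul0r.
  rewrite big_nat_recr //= IH // natrD -mul2n natrM -[k.+1%:R]natr1 -[o.+1%:R]natr1.
  by ring.
transitivity (\sum_(s <= l < h) (l.*2 + o.+1)%:R : R).
  rewrite -(big_mkord xpredT (fun l => (l.*2 + o.+1)%:R * (central h o l r)%:R)).
  rewrite (big_cat_nat (n := s)) //= big_nat big1 ?add0r.
    rewrite big_nat [RHS]big_nat; apply: eq_bigr => l /andP[sl lh].
    have -> : central h o l r by rewrite /central; move: sl; rewrite /s; lia.
    by rewrite mulr1.
  move=> l ls.
  have -> : central h o l r = false by rewrite /central; move: ls; rewrite /s; lia.
  by rewrite mulr0.
rewrite E // natrD -mul2n natrM.
have [rh|rh] := leqP r h.
  have -> : s = (h - r)%N by rewrite /s; lia.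
  by rewrite natrB //; ring.
have -> : s = (r - (h + o))%N by rewrite /s; lia.
rewrite natrB ?natrD; [by ring | lia].
Qed.

(** With [s] listed by decreasing [X], an arc goes to the point of smaller [X]: the out-arcs of a
    point are the up steps of its walk inside the window, the in-arcs its down steps. *)
Definition central_arc (R : realDomainType) (T : finType) (X Y : T -> R) (x0 : T)
    (s : seq T) (h o l i j : nat) : bool :=
  [&& (i < j)%N, (j < size s)%N & central h o l (below X Y (nth x0 s i) (nth x0 s j))].

Lemma sum_class_nth (V : nmodType) (T : finType) (A : {set T}) (x0 : T) (s : seq T)
    (F : T -> V) :
  perm_eq s (enum A) -> \sum_(a in A) F a = \sum_(0 <= i < size s) F (nth x0 s i).
Proof. by move=> ps; rewrite -big_enum -(perm_big _ ps) /= (big_nth x0). Qed.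

(** By [walk_below] with potential [central_count], up steps minus down steps in the window number
    at most its width. Points outside [A] add only up steps, so the bound persists when they are
    dropped. *)
Lemma central_arc_near_balanced (R : realFieldType) (T : finType) (X Y : T -> R)
    (A : {set T}) (x0 : T) (s : seq T) (h o l : nat) :
  injective X -> generic X Y -> (forall a q, a \in A -> q \notin A -> X q < X a) ->
  perm_eq s (enum A) -> uniq s ->
  (forall i j, (i < j)%N -> (j < size s)%N -> X (nth x0 s j) < X (nth x0 s i)) ->
  (l <= h)%N ->
  near_balanced (central_arc X Y x0 s h o l) (l.*2 + o.+1) (size s).
Proof.
move=> Xi gen top ps us dec lh i il.
set p := nth x0 s i; set E := central_arc X Y x0 s h o l.
have sA q : (q \in s) = (q \in A) by rewrite (perm_mem ps) mem_enum.
have pA : p \in A by rewrite -sA mem_nth.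
pose c q : R := (central h o l (below X Y p q))%:R.
have := walk_below (fun k => (central_count h o l k)%:R : R) p Xi gen.
rewrite (bigID (mem A)) /= => H.
have inA : \sum_(q | (q != p) && (q \in A)) (if X q < X p
      then (central_count h o l (below X Y p q).+1)%:R - (central_count h o l (below X Y p q))%:R
      else (central_count h o l (below X Y p q))%:R - (central_count h o l (below X Y p q).+1)%:R)
    = \sum_(0 <= j < size s) (E i j)%:R - \sum_(0 <= j < size s) (E j i)%:R :> R.
  rewrite -sumrB.
  transitivity (\sum_(q in A) (if q != p then if X q < X p then c q else - c q else 0)).
    rewrite -big_mkcondr; apply: eq_big => q; first by rewrite andbC.
    by case: ifP => _ _; rewrite ?central_countS // -opprB central_countS.
  rewrite (sum_class_nth x0 _ ps) big_nat [RHS]big_nat; apply: eq_bigr => j /andP[_ js].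
  rewrite nth_uniq // /E /central_arc js il /=.
  case: (ltngtP i j) => [ij|ij|->] /=; last by rewrite subrr.
    by rewrite dec // subr0.
  by rewrite ltNge (ltW (dec _ _ ij il)) /= sub0r below_sym.
have outA : 0 <= \sum_(q | (q != p) && (q \notin A)) (if X q < X p
      then (central_count h o l (below X Y p q).+1)%:R - (central_count h o l (below X Y p q))%:R
      else (central_count h o l (below X Y p q))%:R - (central_count h o l (below X Y p q).+1)%:R) :> R.
  by apply: sumr_ge0 => q /andP[_ qA]; rewrite top // central_countS.
have le U D : (central_count h o l U)%:R - (central_count h o l D)%:R <= (l.*2 + o.+1)%:R :> R.
  have : (central_count h o l U)%:R <= (l.*2 + o.+1)%:R :> R.
    by rewrite ler_nat /central_count; lia.
  have : 0 <= (central_count h o l D)%:R :> R by [].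
  lra.
move: H outA (le #|[pred q | X q < X p]| #|[pred q | X p < X q]|) => <-.
rewrite inA -(ler_nat R) !natrD !natr_sum.
lra.
Qed.

(** [sum_central] splits every weight over the windows; the factor 2 appears because ordered pairs
    count each arc from both ends. *)
Lemma sum_inner (R : realFieldType) (T : finType) (X Y : T -> R) (A : {set T})
    (x0 : T) (s : seq T) (h o : nat) :
  perm_eq s (enum A) -> uniq s -> (h.*2 + o = #|T| - 2)%N -> (o <= 1)%N ->
  \sum_(a in A) \sum_(q in A | q != a) pair_weight X Y a q
    = 2 * \sum_(l < h) (l.*2 + o.+1)%:R
            * (arcs (central_arc X Y x0 s h o l) (size s))%:R.
Proof.
move=> ps us hN o1.
pose c l i j : R := (central h o l (below X Y (nth x0 s i) (nth x0 s j)))%:R.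
transitivity (\sum_(0 <= i < size s) \sum_(0 <= j < size s)
   \sum_(l < h) (l.*2 + o.+1)%:R * (if j != i then c l i j else 0)).
  rewrite (sum_class_nth x0 _ ps) big_nat [RHS]big_nat; apply: eq_bigr => i /andP[_ il].
  rewrite big_mkcondr (sum_class_nth x0 _ ps) big_nat [RHS]big_nat.
  apply: eq_bigr => j /andP[_ jl]; rewrite nth_uniq //.
  case: eqP => /= [_|/eqP ji]; first by rewrite big1 // => l _; rewrite mulr0.
  rewrite /pair_weight -hN sum_central // hN below_le //.
  by rewrite nth_uniq // eq_sym.
under eq_bigr do rewrite exchange_big /=.
rewrite exchange_big mulr_sumr; apply: eq_bigr => l _ /=.
transitivity ((l.*2 + o.+1)%:R * (\sum_(0 <= i < size s) \sum_(0 <= j < size s)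
   ((central_arc X Y x0 s h o l i j)%:R + (central_arc X Y x0 s h o l j i)%:R)) : R).
  rewrite mulr_sumr big_nat [RHS]big_nat; apply: eq_bigr => i /andP[_ il].
  rewrite -mulr_sumr; congr (_ * _).
  rewrite big_nat [RHS]big_nat; apply: eq_bigr => j /andP[_ jl].
  rewrite /central_arc il jl /c /=.
  case: (ltngtP i j) => /= [_|_|_]; rewrite ?addr0 ?add0r //.
  by rewrite below_sym.
rewrite mulrCA; congr (_ * _).
under eq_bigr do rewrite big_split /=.
rewrite big_split /= [X in _ + X]exchange_big /= /arcs natr_sum.
under [in RHS]eq_bigr do rewrite natr_sum.
by rewrite mulr_natl mulr2n.
Qed.

Lemma class_weight_le (R : realType) (T : finType) (X Y : T -> R) (A : {set T}) (m : nat) :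
  (0 < m)%N -> #|T| = (3 * m)%N -> #|A| = m ->
  injective X -> generic X Y -> (forall a q, a \in A -> q \notin A -> X q < X a) ->
  \sum_(a in A) \sum_(q | q != a) pair_weight X Y a q
    <= (17 / 4 + pi ^+ 2 / 6) * m%:R ^+ 4 + 18 * m%:R ^+ 3.
Proof.
move=> m0 Tm Am Xi gen top.
have split a : a \in A -> \sum_(q | q != a) pair_weight X Y a q
    = \sum_(q in A | q != a) pair_weight X Y a q + \sum_(q | q \notin A) pair_weight X Y a q.
  move=> aA; rewrite (bigID (mem A)) /=; congr (_ + _).
    by apply: eq_bigl => q; rewrite andbC.
  by apply: eq_bigl => q; have [->|] := eqVneq q a; rewrite ?aA.
rewrite (eq_bigr _ split) big_split /= sum_outer // Am Tm.
have [x0 x0A] : exists x0, x0 \in A.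
  by apply/set0Pn; rewrite -card_gt0 Am.
have [s [ps us sz dec]] := decreasing_enum A x0 Xi.
pose o := odd (3 * m - 2); pose h := (3 * m - 2)./2.
have hN : (h.*2 + o = 3 * m - 2)%N by rewrite addnC odd_double_half.
have o1 : (o <= 1)%N by case: (o).
rewrite (@sum_inner _ _ _ _ _ x0 s h o) ?Tm // sz Am.
have inner := @weighted_layers_le R m h o
  (fun l => (arcs (central_arc X Y x0 s h o l) m)%:R) m0 hN o1.
have outer := sum_cumul_le R m0.
(* Twice the bound for the inner pairs plus the bound for the outer pairs. *)
have -> : (17 / 4 + pi ^+ 2 / 6) * m%:R ^+ 4 + 18 * m%:R ^+ 3
  = 2 * ((9 / 8 - (10 - pi ^+ 2) / 12) * m%:R ^+ 4 + 4 * m%:R ^+ 3)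
    + (11 / 3 * m%:R ^+ 4 + 10 * m%:R ^+ 3) :> R by move: pi => p; field.
apply: lerD outer; rewrite ler_pM2l // inner // => l lh.
apply: (@arcs_le_max _ _ (l.*2 + o.+1)%N) => //.
- by move=> i j /andP[].
- by rewrite -Am -sz; exact: (central_arc_near_balanced o Xi gen top ps us dec (ltnW lh)).
- by rewrite addnS.
Qed.

(** * From separations to crossings *)

Definition separates (R : realDomainType) (T : Type) (X Y : T -> R) (p q r s : T) : bool :=
  orient X Y p q r * orient X Y p q s < 0.

(** The line [pq] separates [r] and [s] when one dual line passes below the crossing of [p] and [q]
    and the other above; the factor 2 is the order of [r] and [s]. *)
Lemma sum_separates (R : realFieldType) (T : finType) (X Y : T -> R) (p q : T) :
  injective X -> generic X Y -> p != q ->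
  \sum_r \sum_s (separates X Y p q r s)%:R = 2 * pair_weight X Y p q.
Proof.
move=> Xi gen pq.
pose f r := orient X Y p q r * (X q - X p).
pose lo r := f r < 0; pose hi r := 0 < f r.
have d0 : 0 < (X q - X p) ^+ 2.
  by rewrite exprn_even_gt0 //= subr_eq0 (inj_eq Xi) eq_sym.
have sepE r s : (separates X Y p q r s)%:R
    = (lo r)%:R * (hi s)%:R + (hi r)%:R * (lo s)%:R :> R.
  have -> : separates X Y p q r s = (f r * f s < 0).
    have -> : f r * f s = (X q - X p) ^+ 2 * (orient X Y p q r * orient X Y p q s).
      by rewrite /f; ring.
    by rewrite pmulr_rlt0.
  rewrite /lo /hi; case: (ltgtP (f r) 0) => [h|h|->];
    rewrite /= ?mul0r ?mul1r ?addr0 ?add0r ?ltxx //.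
    by rewrite nmulr_rlt0.
  by rewrite pmulr_rlt0.
under eq_bigr do under eq_bigr do rewrite sepE.
under eq_bigr do rewrite big_split /= -!mulr_sumr.
rewrite big_split /= -!mulr_suml.
have -> (x y : R) : x * y + y * x = 2 * (x * y) by ring.
congr (_ * _).
have -> : \sum_r (lo r)%:R = (below X Y p q)%:R :> R.
  rewrite -natr_sum /below -sum1_card [in RHS]big_mkcond; congr (_%:R).
rewrite /pair_weight; congr (_ * _).
have E r : (hi r)%:R = 1 - (r \in pred2 p q)%:R - (lo r)%:R :> R.
  rewrite !inE /hi /lo; have [->|rp] := eqVneq r p.
    by rewrite /f /orient !subrr !mulr0 subrr mul0r ltxx /=; ring.
  have [->|rq] := eqVneq r q.
    by rewrite /f /orient [_ * (Y q - Y p)]mulrC subrr mul0r ltxx /=; ring.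
  have : f r != 0.
    rewrite mulf_neq0 //; first by apply: gen; rewrite // eq_sym.
    by rewrite subr_eq0 (inj_eq Xi) eq_sym.
  by case: (ltgtP (f r) 0) => //= _ _; ring.
under eq_bigr do rewrite E.
rewrite !sumrB -!natr_sum natrB; last first.
  by rewrite -[2%N](_ : #|pred2 p q| = 2%N) ?max_card // card2 pq.
congr (_ - _ - _); first by rewrite sumr_const.
  have -> : 2 = #|pred2 p q|%:R :> R by rewrite card2 pq.
  rewrite -sum1_card [in RHS]big_mkcond; congr (_%:R).
rewrite /below -sum1_card [in RHS]big_mkcond; congr (_%:R).
Qed.

(* [a], [b], [c], [d] are, up to sign, the orientations of the four triples of a
   4-set; the line through two points separates the other two iff the
   corresponding two numbers have the same sign. *)
Lemma four_signs (R : realFieldType) (a b c d : R) :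
  a != 0 -> b != 0 -> c != 0 -> d != 0 -> a + b + c + d = 0 ->
  (3 <= (0 < c * d)%R + (0 < a * b)%R + (0 < b * d)%R + (0 < a * c)%R
        + (0 < b * c)%R + (0 < a * d)%R
        + ((0 < c * d)%R && (0 < a * b)%R) + ((0 < b * d)%R && (0 < a * c)%R)
        + ((0 < b * c)%R && (0 < a * d)%R))%N.
Proof.
have pm (x y : R) : x != 0 -> y != 0 -> (0 < x * y) = ((0 < x) == (0 < y)).
  by case: (ltgtP x 0) => // hx; case: (ltgtP y 0) => // hy _ _;
    rewrite ?(nmulr_rgt0 _ hx) ?(pmulr_rgt0 _ hx) ?hy // ltNge ltW.
move=> a0 b0 c0 d0 s0; rewrite !pm //.
by case: (ltgtP a 0) a0 => // ha _; case: (ltgtP b 0) b0 => // hb _;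
  case: (ltgtP c 0) c0 => // hc _; case: (ltgtP d 0) d0 => // hd _ //=; exfalso; lra.
Qed.

Definition crosses (R : realDomainType) (T : Type) (X Y : T -> R) (p q r s : T) : bool :=
  separates X Y p q r s && separates X Y r s p q.

(** In convex position the two diagonals separate and cross, giving 2 + 1; otherwise the three lines
    through the inner point separate, giving 3 + 0. The signed orientations sum to zero, so they
    cannot all have the same sign. *)
Lemma four_points (R : realFieldType) (T : finType) (X Y : T -> R) (p q r s : T) :
  generic X Y -> uniq [:: s; r; q; p] ->
  (3 <= separates X Y p q r s + separates X Y r s p q
      + separates X Y p r q s + separates X Y q s p r
      + separates X Y p s q r + separates X Y q r p s
      + crosses X Y p q r s + crosses X Y p r q s + crosses X Y p s q r)%N.
Proof.
move=> gen; rewrite /= !inE !negb_or andbT ![_ == p]eq_sym ![_ == q]eq_sym [_ == r]eq_sym.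
move=> /and3P[/and3P[rs qs ps] /andP[qr pr] qp].
have pq : p != q by rewrite eq_sym.
pose a := orient X Y q r s; pose b := - orient X Y p r s.
pose c := orient X Y p q s; pose d := - orient X Y p q r.
have sepE (u v w z : T) (x y : R) :
    orient X Y u v w * orient X Y u v z = - (x * y) -> separates X Y u v w z = (0 < x * y).
  by rewrite /separates => ->; rewrite oppr_lt0.
rewrite /crosses (sepE p q r s c d) ?(sepE r s p q a b) ?(sepE p r q s b d)
  ?(sepE q s p r a c) ?(sepE p s q r b c) ?(sepE q r p s a d);
  try by rewrite /a /b /c /d /orient; ring.
apply: four_signs; rewrite /a /b /c /d ?oppr_eq0; try exact: gen.
by rewrite /orient; ring.
Qed.

Lemma sum_uniq_cons (T : finType) (k : nat) (l : seq T) :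
  size l = k -> (\sum_x uniq (x :: l) = (#|T| - k) * uniq l)%N.
Proof.
move=> <-.
have [ul|nul] := boolP (uniq l); last first.
  by rewrite muln0 big1 // => x _; rewrite /= (negbTE nul) andbF.
rewrite muln1 -(card_uniqP ul) -(cardC (mem l)) addKn -sum1_card [RHS]big_mkcond.
by apply: eq_bigr => x _; rewrite /= ul andbT !inE; case: ifP.
Qed.

Lemma sum_uniq4 (T : finType) :
  (\sum_(p : T) \sum_q \sum_r \sum_s uniq [:: s; r; q; p] = #|T| ^_ 4)%N.
Proof.
under eq_bigr do under eq_bigr do under eq_bigr do rewrite (@sum_uniq_cons _ 3) //.
under eq_bigr do under eq_bigr do rewrite -big_distrr (@sum_uniq_cons _ 2) //=.
under eq_bigr do rewrite -!big_distrr (@sum_uniq_cons _ 1) //=.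
rewrite -!big_distrr sum1_card /= !ffactnSr ffactn0 subn0 mul1n.
by ring.
Qed.

Definition quad_sum (T : finType) (F : T -> T -> T -> T -> nat) : nat :=
  (\sum_p \sum_q \sum_r \sum_s F p q r s)%N.

Lemma quad_sumD (T : finType) (F G : T -> T -> T -> T -> nat) :
  quad_sum (fun p q r s => F p q r s + G p q r s)%N = (quad_sum F + quad_sum G)%N.
Proof.
rewrite /quad_sum.
under eq_bigr do under eq_bigr do under eq_bigr do rewrite big_split.
under eq_bigr do under eq_bigr do rewrite big_split.
under eq_bigr do rewrite big_split.
by rewrite big_split.
Qed.

Lemma quad_sum_swap12 (T : finType) (F : T -> T -> T -> T -> nat) :
  quad_sum (fun p q r s => F q p r s) = quad_sum F.
Proof. by rewrite /quad_sum exchange_big. Qed.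

Lemma quad_sum_swap23 (T : finType) (F : T -> T -> T -> T -> nat) :
  quad_sum (fun p q r s => F p r q s) = quad_sum F.
Proof. by apply: eq_bigr => p _; rewrite exchange_big. Qed.

Lemma quad_sum_swap34 (T : finType) (F : T -> T -> T -> T -> nat) :
  quad_sum (fun p q r s => F p q s r) = quad_sum F.
Proof. by apply: eq_bigr => p _; apply: eq_bigr => q _; rewrite exchange_big. Qed.

Lemma quad_sum_swap24 (T : finType) (F : T -> T -> T -> T -> nat) :
  quad_sum (fun p q r s => F p s q r) = quad_sum F.
Proof.
exact: etrans (quad_sum_swap34 (fun p q r s => F p r q s)) (quad_sum_swap23 F).
Qed.

Lemma quad_sum_swap_pairs (T : finType) (F : T -> T -> T -> T -> nat) :
  quad_sum (fun p q r s => F r s p q) = quad_sum F.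
Proof.
apply: etrans (quad_sum_swap23 (fun p q r s => F q s p r)) _.
apply: etrans (quad_sum_swap34 (fun p q r s => F q r p s)) _.
exact: etrans (quad_sum_swap12 (fun p q r s => F p r q s)) (quad_sum_swap23 F).
Qed.

(** Sum [four_points] over ordered quadruples: by relabelling, the six separation terms have equal
    sums, and so do the three crossing terms. Then divide by 3. *)
Lemma ffact4_le_separates (R : realFieldType) (T : finType) (X Y : T -> R) :
  generic X Y ->
  (#|T| ^_ 4 <= 2 * quad_sum (separates X Y) + quad_sum (crosses X Y))%N.
Proof.
move=> gen; rewrite -(leq_pmul2l (isT : 0 < 3)%N).
pose S : T -> T -> T -> T -> nat := separates X Y.
pose C : T -> T -> T -> T -> nat := crosses X Y.
apply: (@leq_trans (quad_sum (fun p q r s => S p q r s + S r s p q + S p r q s + S q s p r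
      + S p s q r + S q r p s + C p q r s + C p r q s + C p s q r)%N)); last first.
  have E1 : quad_sum (fun p q r s => S q s p r) = quad_sum S.
    exact: etrans (quad_sum_swap23 (fun p q r s => S r s p q)) (quad_sum_swap_pairs S).
  have E2 : quad_sum (fun p q r s => S q r p s) = quad_sum S.
    exact: etrans (quad_sum_swap12 (fun p q r s => S p r q s)) (quad_sum_swap23 S).
  rewrite !quad_sumD (quad_sum_swap_pairs S) (quad_sum_swap23 S) E1.
  rewrite (quad_sum_swap24 S) E2 (quad_sum_swap23 C) (quad_sum_swap24 C).
  rewrite -/S -/C; clear; move: (quad_sum _) (quad_sum _) => a b.

  lia.
rewrite -sum_uniq4 big_distrr; apply: leq_sum => p _.
rewrite big_distrr; apply: leq_sum => q _.
rewrite big_distrr; apply: leq_sum => r _.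
rewrite big_distrr; apply: leq_sum => s _.
have := @four_points _ _ X Y p q r s gen.
case: (uniq _) => [/(_ isT)|_]; last by rewrite /= muln0.
by [].
Qed.

(** * Choice of a direction *)

Lemma small_common (R : realFieldType) (I : eqType) (P : I -> R -> Prop) (s : seq I) :
  (forall i, exists2 d, 0 < d & forall e, 0 < e -> e <= d -> P i e) ->
  exists2 e, 0 < e & forall i, i \in s -> P i e.
Proof.
move=> H.
suff [d d0 Hd] : exists2 d, 0 < d & forall e, 0 < e -> e <= d -> forall i, i \in s -> P i e.
  by exists d => // i; apply: Hd.
elim: s => [|i s [d d0 Hd]]; first by exists 1.
have [d' d'0 Hd'] := H i.
exists (Num.min d d') => [|e e0]; first by rewrite lt_min d0.
rewrite le_min => /andP[ed ed'] j; rewrite inE => /orP[/eqP ->|js].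
  exact: Hd'.
exact: Hd.
Qed.

Lemma small_perturbation (R : realFieldType) (a b : R) : (a != 0) || (b != 0) ->
  exists2 d, 0 < d & forall e, 0 < e -> e <= d ->
    a + e * b != 0 /\ (0 < a -> 0 < a + e * b).
Proof.
have [-> /= b0|a0 _] := eqVneq a 0.
  exists 1 => // e e0 _; rewrite add0r mulf_neq0 ?(gt_eqF e0) //.
  by rewrite ltxx.
have b1 : 0 < `|b| + 1 by rewrite ltr_pwDr.
(* Below this threshold the perturbation is smaller than [a] in absolute value; the [+ 1] covers
   [b = 0]. *)
exists (`|a| / (`|b| + 1)); first by rewrite divr_gt0 ?normr_gt0.
move=> e e0; rewrite ler_pdivlMr // => ed.
have eb : `|e * b| < `|a|.
  rewrite normrM gtr0_norm //; apply: lt_le_trans ed.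
  by rewrite ltr_pM2l // ltrDl.
split.
  apply: contraTneq eb => /eqP; rewrite addr_eq0 => /eqP ->.
  by rewrite normrN ltxx.
move=> ap; move: eb; rewrite (gtr0_norm ap) ltr_norml => /andP[]; lra.
Qed.

(** Turn [u] slightly towards its perpendicular, along which [g] projects. Distinct points differ in
    [f] or [g], so small turns separate them, and the finitely many strict inequalities defining
    extremality survive. *)
Lemma generic_direction (R : realFieldType) (T : finType) (x y : T -> R) (A : {set T}) (u0 u1 : R) :
  (forall p q, x p = x q -> y p = y q -> p = q) ->
  (u0 != 0) || (u1 != 0) ->
  (forall a q, a \in A -> q \notin A -> u0 * x q + u1 * y q < u0 * x a + u1 * y a) ->
  exists w0 w1 : R, injective (fun p => w0 * x p + w1 * y p) /\
    (forall a q, a \in A -> q \notin A -> w0 * x q + w1 * y q < w0 * x a + w1 * y a).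
Proof.
move=> inj u00 top.
pose f p := u0 * x p + u1 * y p; pose g p := u0 * y p - u1 * x p.
have fg p q : p != q -> (f p - f q != 0) || (g p - g q != 0).
  apply: contraNT; rewrite negb_or !negbK => /andP[/eqP hf /eqP hg].
  have u2 : 0 < u0 ^+ 2 + u1 ^+ 2.
    rewrite lt_neqAle addr_ge0 ?sqr_ge0 // andbT eq_sym paddr_eq0 ?sqr_ge0 //.
    by rewrite !sqrf_eq0 negb_and.
  have hx : (u0 ^+ 2 + u1 ^+ 2) * (x p - x q) = 0.
    have -> : (u0 ^+ 2 + u1 ^+ 2) * (x p - x q) = u0 * (f p - f q) - u1 * (g p - g q).
      by rewrite /f /g; ring.
    by rewrite hf hg !mulr0 subrr.
  have hy : (u0 ^+ 2 + u1 ^+ 2) * (y p - y q) = 0.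
    have -> : (u0 ^+ 2 + u1 ^+ 2) * (y p - y q) = u1 * (f p - f q) + u0 * (g p - g q).
      by rewrite /f /g; ring.
    by rewrite hf hg !mulr0 addr0.
  move/eqP: hx; rewrite mulf_eq0 (gt_eqF u2) subr_eq0 => /eqP hx.
  move/eqP: hy; rewrite mulf_eq0 (gt_eqF u2) subr_eq0 => /eqP hy.
  by apply/eqP/inj.
have [|e e0 He] := @small_common R (T * T)%type (fun t e => t.1 != t.2 ->
    f t.1 - f t.2 + e * (g t.1 - g t.2) != 0 /\
    (0 < f t.1 - f t.2 -> 0 < f t.1 - f t.2 + e * (g t.1 - g t.2))) (enum {: T * T}).
  move=> [p q] /=; have [->|pq] := eqVneq p q; first by exists 1.
  have [d d0 Hd] := small_perturbation (fg p q pq).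
  by exists d => // e e0 ed _; apply: Hd.
have E p q : (u0 - e * u1) * x p + (u1 + e * u0) * y p - ((u0 - e * u1) * x q + (u1 + e * u0) * y q)
   = f p - f q + e * (g p - g q) by rewrite /f /g; ring.
exists (u0 - e * u1), (u1 + e * u0); split.
  move=> p q /eqP; rewrite -subr_eq0 E => h; apply/eqP; apply: contraTT h => pq.
  by have [] := He (p, q) (mem_enum _ _) pq.
move=> a q aA qA; rewrite -subr_gt0 E.
have aq : a != q by apply: contraNneq qA => <-.
have [_] := He (a, q) (mem_enum _ _) aq; apply.
by rewrite /= subr_gt0; apply: top.
Qed.

Lemma orient_rotate (R : realFieldType) (T : Type) (x y : T -> R) (w0 w1 : R) (p q r : T) :
  orient (fun p => w0 * x p + w1 * y p) (fun p => w0 * y p - w1 * x p) p q r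
    = (w0 ^+ 2 + w1 ^+ 2) * orient x y p q r.
Proof. by rewrite /orient; ring. Qed.

(** Take the perturbed extreme direction as the [X] axis. The change of coordinates multiplies
    orientations by a positive constant, so separations are unchanged and [class_weight_le]
    applies. *)
Lemma class_separates_le (R : realType) (T : finType) (x y : T -> R) (A : {set T}) (m : nat)
    (u0 u1 : R) :
  (0 < m)%N -> #|T| = (3 * m)%N -> #|A| = m -> generic x y ->
  (forall p q, x p = x q -> y p = y q -> p = q) ->
  (forall a q, a \in A -> q \notin A -> u0 * x q + u1 * y q < u0 * x a + u1 * y a) ->
  \sum_(p in A) \sum_q \sum_r \sum_s (separates x y p q r s)%:R
    <= 2 * ((17 / 4 + pi ^+ 2 / 6) * m%:R ^+ 4 + 18 * m%:R ^+ 3) :> R.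
Proof.
move=> m0 Tm Am gen inj top.
have [a0 a0A] : exists a, a \in A by apply/set0Pn; rewrite -card_gt0 Am.
have [q0 q0A] : exists q, q \notin A.
  have : (0 < #|~: A|)%N by have := cardsC A; rewrite Am Tm; lia.
  by rewrite card_gt0 => /set0Pn[q]; rewrite inE; exists q.
have u00 : (u0 != 0) || (u1 != 0).
  have := top _ _ a0A q0A; apply: contraTT; rewrite negb_or !negbK => /andP[/eqP -> /eqP ->].
  by rewrite !mul0r ltxx.
have [w0 [w1 [Xi Xtop]]] := generic_direction inj u00 top.
pose X p := w0 * x p + w1 * y p; pose Y p := w0 * y p - w1 * x p.
have k0 : 0 < w0 ^+ 2 + w1 ^+ 2.
  rewrite lt_neqAle addr_ge0 ?sqr_ge0 // andbT eq_sym paddr_eq0 ?sqr_ge0 //.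
  have := Xtop _ _ a0A q0A; apply: contraTN; rewrite !sqrf_eq0 => /andP[/eqP -> /eqP ->].
  by rewrite !mul0r ltxx.
have oE p q r : orient X Y p q r = (w0 ^+ 2 + w1 ^+ 2) * orient x y p q r.
  exact: orient_rotate.
have genX : generic X Y.
  by move=> p q r pq qr pr; rewrite oE mulf_neq0 ?(gt_eqF k0) // gen.
have sE p q r s : separates x y p q r s = separates X Y p q r s.
  have kk : 0 < (w0 ^+ 2 + w1 ^+ 2) * (w0 ^+ 2 + w1 ^+ 2) by apply: mulr_gt0.
  by rewrite /separates !oE mulrACA (pmulr_rlt0 _ kk).
have -> : \sum_(p in A) \sum_q \sum_r \sum_s (separates x y p q r s)%:R
   = 2 * \sum_(p in A) \sum_(q | q != p) pair_weight X Y p q.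
  rewrite mulr_sumr; apply: eq_bigr => p _; rewrite mulr_sumr (bigD1 p) //=.
  rewrite big1 ?add0r; last first.
    move=> r _; rewrite big1 // => s _.
    by rewrite /separates /orient !subrr !mul0r subrr mul0r ltxx.
  apply: eq_bigr => q qp; rewrite -sum_separates //; last by rewrite eq_sym.
  by apply: eq_bigr => r _; apply: eq_bigr => s _; rewrite sE.
by rewrite ler_pM2l // class_weight_le.
Qed.

(** * Point sets of the plane *)

Lemma fset2_eq (K : choiceType) (a b c d : K) :
  [fset a; b]%fset = [fset c; d]%fset -> (a = c /\ b = d) \/ (a = d /\ b = c).
Proof.
move=> E; have mem x : (x \in [fset a; b]%fset) = (x \in [fset c; d]%fset) by rewrite E.
have := mem a; have := mem b; have := mem c; have := mem d.
rewrite !inE !eqxx !orbT /=.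
move=> /orP[/eqP h1|/eqP h1] /orP[/eqP h2|/eqP h2];
  move=> /esym/orP[/eqP h3|/eqP h3] /esym/orP[/eqP h4|/eqP h4]; subst; tauto.
Qed.

Definition abscissa (R : realType) (P : {fset 'rV[R]_2}) (p : P) : R := val p 0 0.
Definition ordinate (R : realType) (P : {fset 'rV[R]_2}) (p : P) : R := val p 0 1.

Lemma rV2P (R : realType) (u v : 'rV[R]_2) : u 0 0 = v 0 0 -> u 0 1 = v 0 1 -> u = v.
Proof.
move=> h0 h1; apply/rowP => i; case: i => [[|[|i]] hi] //.
  by rewrite (_ : Ordinal hi = 0) //; apply/val_inj.
by rewrite (_ : Ordinal hi = 1) //; apply/val_inj.
Qed.

Lemma coordinates_inj (R : realType) (P : {fset 'rV[R]_2}) (p q : P) :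
  abscissa p = abscissa q -> ordinate p = ordinate q -> p = q.
Proof. by move=> h0 h1; apply/val_inj/rV2P. Qed.

Lemma general_position_generic (R : realType) (P : {fset 'rV[R]_2}) :
  general_position P -> generic (@abscissa R P) (@ordinate R P).
Proof.
move=> gp p q r pq qr pr; apply/eqP => o0.
suff : collinear (val p) (val q) (val r).
  by apply: gp; rewrite ?(inj_eq val_inj) //; apply: valP.
exists (val p), (val q - val p); split.
  by rewrite subr_eq0 (inj_eq val_inj) eq_sym.
have [s Hs] : exists s : R, val r = val p + s *: (val q - val p).
  have qp : (abscissa q != abscissa p) || (ordinate q != ordinate p).
    rewrite -negb_and; apply: contra pq => /andP[/eqP h0 /eqP h1].
    by apply/eqP/coordinates_inj.
  move: o0 qp; rewrite /orient /abscissa /ordinate => o0 qp.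
  case/orP: qp; rewrite -subr_eq0 => h.
    exists ((val r 0 0 - val p 0 0) / (val q 0 0 - val p 0 0)).
    apply: rV2P; rewrite !mxE; first by field.
    apply: (mulfI h); rewrite mulrDr mulrA [_ * (_ / _)]mulrC divfK //.
    lra.
  exists ((val r 0 1 - val p 0 1) / (val q 0 1 - val p 0 1)).
  apply: rV2P; rewrite !mxE; last by field.
  apply: (mulfI h); rewrite mulrDr mulrA [_ * (_ / _)]mulrC divfK //.
  lra.
move=> x; rewrite !inE => /or3P[] /eqP ->.
- by exists 0; rewrite scale0r addr0.
- by exists 1; rewrite scale1r addrC subrK.
- by exists s.
Qed.

Lemma separates_neq (R : realType) (T : eqType) (X Y : T -> R) (p q r s : T) :
  separates X Y p q r s -> p != q /\ r != s.
Proof.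
rewrite /separates => h; split; apply: contraTneq h => ->.
  by rewrite /orient !subrr !mul0r subrr mul0r ltxx.
by rewrite -expr2 ltNge sqr_ge0.
Qed.

Lemma crosses_cross (R : realType) (P : {fset 'rV[R]_2}) (p q r s : P) :
  crosses (@abscissa R P) (@ordinate R P) p q r s ->
  cross [fset val p; val q]%fset [fset val r; val s]%fset.
Proof.
move=> /andP[h1 h2].
pose o := orient (@abscissa R P) (@ordinate R P).
have key (a b : R) : a * b < 0 -> 0 < a / (a - b) < 1 /\ a - b != 0.
  have [b0|b0|->] := ltgtP b 0; last by rewrite mulr0 ltxx.
    rewrite nmulr_llt0 // => a0; have ab : 0 < a - b by rewrite subr_gt0 (lt_trans b0).
    by rewrite divr_gt0 // ltr_pdivrMr // mul1r (gt_eqF ab); split=> //; lra.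
  rewrite pmulr_llt0 // => a0; have ab : a - b < 0 by rewrite subr_lt0 (lt_trans a0).
  split; last by rewrite (lt_eqF ab).
  by rewrite -[a / _]mulrNN -invrN divr_gt0 ?oppr_gt0 // ltr_pdivrMr ?oppr_gt0 // mul1r; lra.
(* The intersection point divides each segment in the ratio of the orientations of its ends with
   respect to the other line; opposite signs put the parameter strictly between 0 and 1. *)
have [t01 t0] := key _ _ h2; have [u01 u0] := key _ _ h1.
set t := _ / _ in t01; set u := _ / _ in u01.
exists ((1 - t) *: val p + t *: val q); split.
  by exists (val p), (val q), t.
exists (val r), (val s), u; split=> //.
move: t0 u0; rewrite /t /u /orient /abscissa /ordinate => t0 u0.
by apply: rV2P; rewrite !mxE; field; rewrite t0 u0.
Qed.

(* The set counted by [crossing_number]. *)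
Definition crossing_pairs (R : realType) (P : {fset 'rV[R]_2}) :
    {fset {fset {fset 'rV[R]_2}}} :=
  [fset Z in fpowerset (edges P) |
    `[< exists e f, [/\ Z = [fset e; f]%fset, e != f & cross e f] >]]%fset.

Definition pair_of (R : realType) (P : {fset 'rV[R]_2}) (p q r s : P) :
    {fset {fset 'rV[R]_2}} :=
  [fset [fset val p; val q]; [fset val r; val s]]%fset.

Lemma pair_of_crossing (R : realType) (P : {fset 'rV[R]_2}) (p q r s : P) :
  crosses (@abscissa R P) (@ordinate R P) p q r s ->
  pair_of p q r s \in crossing_pairs P.
Proof.
move=> h; have /andP[h1 h2] := h.
have [pq rs] := separates_neq h1.
have edge (a b : P) : a != b -> [fset val a; val b]%fset \in edges P.
  move=> ab; rewrite !inE fpowersetE cardfs2 (inj_eq val_inj) ab eqxx andbT.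
  by apply/fsubsetP => x; rewrite !inE => /orP[] /eqP ->; apply: valP.
rewrite !inE; apply/andP; split.
  by rewrite fpowersetE; apply/fsubsetP => x; rewrite in_fset2 => /orP[] /eqP ->; apply: edge.
apply/asboolP; exists [fset val p; val q]%fset, [fset val r; val s]%fset; split=> //.
  apply/negP => /eqP/fset2_eq E.
  have op : orient (@abscissa R P) (@ordinate R P) p q p = 0.
    by rewrite /orient !subrr !mulr0 subrr.
  have oq : orient (@abscissa R P) (@ordinate R P) p q q = 0.
    by rewrite /orient mulrC subrr.
  move: h1; rewrite /separates.
  by case: E => -[] /val_inj <- /val_inj <-; rewrite op ?mul0r ?mulr0 ltxx.
exact: crosses_cross.
Qed.

Lemma sum_pred_le (T : finType) (F : pred T) (L : seq T) :
  (forall t, F t -> t \in L) -> (\sum_t F t <= size L)%N.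
Proof.
move=> FL; have -> : (\sum_t F t = #|[pred t | F t]|)%N.
  by rewrite -sum1_card [RHS]big_mkcond; apply: eq_bigr => t _; rewrite inE; case: (F t).
apply: leq_trans (card_size L); apply/subset_leq_card/fintype.subsetP => t.
by rewrite inE; apply: FL.
Qed.

(** A crossing pair of edges arises from at most 8 ordered quadruples: the order of the two edges
    and the order of the ends of each. *)
Lemma sum_crosses_le (R : realType) (P : {fset 'rV[R]_2}) :
  (quad_sum (crosses (@abscissa R P) (@ordinate R P)) <= 8 * crossing_number P)%N.
Proof.
pose X : P -> P -> P -> P -> bool := crosses (@abscissa R P) (@ordinate R P).
pose S := crossing_pairs P.
have -> : crossing_number P = #|{: S}| by rewrite -cardfE.
pose F (Z : S) (t : (P * P) * (P * P)) :=
  X t.1.1 t.1.2 t.2.1 t.2.2 && (pair_of t.1.1 t.1.2 t.2.1 t.2.2 == val Z).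
have fiber Z : (\sum_t F Z t <= 8)%N.
  have [/existsP[t0 /andP[Xt0 /eqP Et0]]|none] := boolP [exists t, F Z t]; last first.
    rewrite big1 // => t _; apply/eqP; rewrite eqb0.
    by move: none; rewrite negb_exists => /forallP.
  case: t0 Xt0 Et0 => [[p q] [r s]] /= _ Et0.
  pose L : seq ((P * P) * (P * P)) := [::
    ((p, q), (r, s)); ((p, q), (s, r)); ((q, p), (r, s)); ((q, p), (s, r));
    ((r, s), (p, q)); ((r, s), (q, p)); ((s, r), (p, q)); ((s, r), (q, p))].
  apply: (@sum_pred_le _ (F Z) L) => -[[p' q'] [r' s']] /andP[_ /= /eqP].
  rewrite -Et0 => E.
  have ML k : (k < 8)%N -> nth ((p, q), (r, s)) L k \in L.
    by move=> k8; apply: mem_nth.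
  case: (fset2_eq E) => -[E1 E2]; case: (fset2_eq E1) => -[/val_inj -> /val_inj ->];
    case: (fset2_eq E2) => -[/val_inj -> /val_inj ->].
  - exact: (ML 0%N).
  - exact: (ML 1%N).
  - exact: (ML 2%N).
  - exact: (ML 3%N).
  - exact: (ML 4%N).
  - exact: (ML 5%N).
  - exact: (ML 6%N).
  - exact: (ML 7%N).
apply: (@leq_trans (\sum_(Z : S) \sum_t F Z t)); last first.
  rewrite (@leq_trans (\sum_(Z : S) 8)) ?leq_sum //.
  by rewrite sum_nat_const mulnC.
rewrite exchange_big /= /quad_sum.
rewrite pair_big /=.
under eq_bigr do rewrite pair_big /=.
rewrite pair_big /=; apply: leq_sum => -[[p q] [r s]] _ /=.
case Xt: (crosses _ _ _ _ _ _) => //=.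
have /= Zt := pair_of_crossing Xt.
by rewrite (bigD1 [` Zt]%fset) //= /F /X /= Xt eqxx.
Qed.

Lemma proj_before_dotp (R : realType) (s t : 'rV[R]_2) (X Y : {fset 'rV[R]_2}) x y :
  proj_before s t X Y -> x \in X -> y \in Y -> dotp x (t - s) < dotp y (t - s).
Proof.
move=> h xX yY; have := h x y xX yY; rewrite /proj_coord.
have D (p u : 'rV[R]_2) : dotp p u = p 0 0 * u 0 0 + p 0 1 * u 0 1.
  by rewrite /dotp big_ord_recl big_ord1; congr (_ + _ * _); congr (_ _ _); apply/val_inj.
set u := t - s.
(* For a degenerate side the division returns 0 on both sides, against the strict inequality. *)
have [->|u0] := eqVneq (dotp u u) 0; first by rewrite invr0 !mulr0 ltxx.
have up : 0 < dotp u u by rewrite lt_neqAle eq_sym u0 D -!expr2 addr_ge0 ?sqr_ge0.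
rewrite ltr_pM2r ?invr_gt0 // !D !mxE; lra.
Qed.

(** Up to sign, the direction of the side works; a point of the middle class links the two end
    classes by transitivity. *)
Lemma proj_between_extreme (R : realType) (s t : 'rV[R]_2) (X Y Z : {fset 'rV[R]_2}) :
  proj_between s t X Y Z -> (exists x, x \in X) ->
  exists u : 'rV[R]_2, forall y q, y \in Y -> (q \in X) || (q \in Z) -> dotp q u < dotp y u.
Proof.
have N (p u : 'rV[R]_2) : dotp p (- u) = - dotp p u.
  by rewrite /dotp -sumrN; apply: eq_bigr => i _; rewrite mxE mulrN.
move=> [[h1 h2]|[h1 h2]] [x xX].
  exists (- (t - s)) => y q yY; rewrite !N ltrN2 => /orP[qX|qZ].
    exact: proj_before_dotp h1 yY qX.
  exact: lt_trans (proj_before_dotp h1 yY xX) (proj_before_dotp h2 xX qZ).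
exists (t - s) => y q yY /orP[qX|qZ].
  exact: proj_before_dotp h2 qX yY.
exact: lt_trans (proj_before_dotp h1 qZ xX) (proj_before_dotp h2 xX yY).
Qed.

Lemma proj_betweenC (R : realType) (s t : 'rV[R]_2) (X Y Z : {fset 'rV[R]_2}) :
  proj_between s t X Y Z -> proj_between s t X Z Y.
Proof. by case=> h; [right | left]. Qed.

Lemma subclass_separates_le (R : realType) (P A : {fset 'rV[R]_2}) (m : nat) (u : 'rV[R]_2) :
  (0 < m)%N -> #|` P| = (3 * m)%N -> #|` A| = m -> (A `<=` P)%fset ->
  general_position P ->
  (forall a q, a \in A -> q \in P -> q \notin A -> dotp q u < dotp a u) ->
  \sum_(p : P | val p \in A) \sum_q \sum_r \sum_s
     (separates (@abscissa R P) (@ordinate R P) p q r s)%:R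
    <= 2 * ((17 / 4 + pi ^+ 2 / 6) * m%:R ^+ 4 + 18 * m%:R ^+ 3) :> R.
Proof.
move=> m0 Pm Am AP gp top.
pose A' := fsub P A.
have -> : \sum_(p : P | val p \in A) \sum_q \sum_r \sum_s
     (separates (@abscissa R P) (@ordinate R P) p q r s)%:R
   = \sum_(p in A') \sum_q \sum_r \sum_s
     (separates (@abscissa R P) (@ordinate R P) p q r s)%:R :> R.
  by apply: eq_bigl => p; rewrite in_fsub.
apply: (@class_separates_le _ _ _ _ _ _ (u 0 0) (u 0 1)) => //.
- by rewrite -cardfE.
- by rewrite card_fsub.
- exact: general_position_generic.
- exact: coordinates_inj.
have D (p : 'rV[R]_2) : u 0 0 * p 0 0 + u 0 1 * p 0 1 = dotp p u.
  rewrite /dotp big_ord_recl big_ord1 [u 0 0 * _]mulrC [u 0 1 * _]mulrC.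
  by congr (_ + _ * _); congr (_ _ _); apply/val_inj.
move=> a q; rewrite !in_fsub => aA qA; rewrite /abscissa /ordinate !D.
by apply: top => //; apply: valP.
Qed.

Lemma three_decomposable_separates_le (R : realType) (P : {fset 'rV[R]_2}) (m : nat) :
  (0 < m)%N -> #|` P| = (3 * m)%N -> general_position P -> three_decomposable P ->
  (quad_sum (separates (@abscissa R P) (@ordinate R P)))%:R
    <= 6 * ((17 / 4 + pi ^+ 2 / 6) * m%:R ^+ 4 + 18 * m%:R ^+ 3) :> R.
Proof.
move=> m0 Pm gp [A [B [C [PE [dAB dBC dAC] [AB BC] [t0 [t1 [t2 [_ _ hA hB _]]]]]]]].
have cardP : #|` P| = (#|` A| + #|` B| + #|` C|)%N.
  move: dAB dBC dAC; rewrite -!fsetI_eq0 => /eqP dAB /eqP dBC /eqP dAC.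
  by rewrite PE !cardfsU fsetIUl dAB dAC dBC fsetU0 cardfs0 !subn0.
have Am : #|` A| = m by move: cardP; rewrite Pm -BC -AB; lia.
have Bm : #|` B| = m by rewrite -AB.
have Cm : #|` C| = m by rewrite -BC.
have ne (Z : {fset 'rV[R]_2}) : #|` Z| = m -> exists z, z \in Z.
  by move=> Zm; apply/fset0Pn; rewrite -cardfs_gt0 Zm.
have sub (Z : {fset 'rV[R]_2}) : Z \in [:: A; B; C] -> (Z `<=` P)%fset.
  rewrite PE !inE => /or3P[] /eqP ->; apply/fsubsetP => z zZ; rewrite !inE zZ ?orbT //.
have inP q : q \in P -> [|| q \in A, q \in B | q \in C].
  by rewrite PE !inE orbA.
(* [A] is an end class on the side where [B] is in the middle; [B] and [C] are the two ends on the
   side where [A] is in the middle. *)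
have [uA HA] := proj_between_extreme hB (ne B Bm).
have [uB HB] := proj_between_extreme hA (ne A Am).
have [uC HC] := proj_between_extreme (proj_betweenC hA) (ne A Am).
have SA := @subclass_separates_le R P A m uA m0 Pm Am (sub A _) gp.
have SB := @subclass_separates_le R P B m uB m0 Pm Bm (sub B _) gp.
have SC := @subclass_separates_le R P C m uC m0 Pm Cm (sub C _) gp.
rewrite /quad_sum natr_sum.
under eq_bigr do rewrite natr_sum.
under eq_bigr do under eq_bigr do rewrite natr_sum.
under eq_bigr do under eq_bigr do under eq_bigr do rewrite natr_sum.
rewrite (bigID (fun p : P => val p \in A)) /=.
rewrite [X in _ + X](bigID (fun p : P => val p \in B)) /=.
have -> : forall x : R, 6 * x = 2 * x + (2 * x + 2 * x) by move=> x; ring.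
have nAB z : z \in B -> z \notin A by move=> zB; apply: contraL zB => zA; apply: (fdisjointP dAB).
have nBC z : z \in C -> z \notin B by move=> zB; apply: contraL zB => zA; apply: (fdisjointP dBC).
have nAC z : z \in C -> z \notin A by move=> zB; apply: contraL zB => zA; apply: (fdisjointP dAC).
apply: lerD; last apply: lerD.
- apply: SA; rewrite ?inE ?eqxx //.
  by move=> a q aA /inP/or3P[->//|qB|qC] _; apply: HA => //; rewrite ?qB ?qC ?orbT.
- rewrite (eq_bigl (fun p : P => val p \in B)); last first.
    by move=> p /=; apply: andb_idl => /nAB.
  apply: SB; rewrite ?inE ?eqxx ?orbT //.
  by move=> a q aA /inP/or3P[qA|->//|qC] _; apply: HB => //; rewrite ?qA ?qC ?orbT.
rewrite (eq_bigl (fun p : P => val p \in C)); last first.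
  move=> p /=; apply/andP/idP => [[pA pB]|pC]; last by rewrite nAC ?nBC.
  by have := inP _ (valP p); rewrite (negbTE pA) (negbTE pB).
apply: SC; rewrite ?inE ?eqxx ?orbT //.
by move=> a q aA /inP/or3P[qA|qB|->//] _; apply: HC => //; rewrite ?qA ?qB ?orbT.
Qed.

Lemma ffact4_ge (R : realFieldType) (n : nat) : (2 < n)%N ->
  n%:R ^+ 4 - 6 * n%:R ^+ 3 <= (n ^_ 4)%:R :> R.
Proof.
move=> n3; rewrite !ffactnSr ffactn0 subn0 mul1n !natrM !natrB //; try lia.
have : 3 <= n%:R :> R by rewrite ler_nat.
move: n%:R => x x3.
have -> : x * (x - 1) * (x - 2) * (x - 3) = x ^+ 4 - 6 * x ^+ 3 + x * (11 * x - 6) by ring.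
by rewrite lerDl mulr_ge0 //; lra.
Qed.

Lemma crossing_number_ge (R : realType) (P : {fset 'rV[R]_2}) (m : nat) :
  (0 < m)%N -> #|` P| = (3 * m)%N -> general_position P -> three_decomposable P ->
  2 / 27 * (15 - pi ^+ 2) * 'C(3 * m, 4)%:R - 2 * (3 * m)%:R ^+ 3
    <= (crossing_number P)%:R :> R.
Proof.
move=> m0 Pm gp dec.
have H1 := three_decomposable_separates_le m0 Pm gp dec.
have := ffact4_le_separates (general_position_generic gp).
rewrite -cardfE Pm => /leq_trans /(_ (leq_add (leqnn _) (sum_crosses_le P))).
have HC : ((3 * m) ^_ 4)%:R = 24 * 'C(3 * m, 4)%:R :> R by rewrite -bin_ffact natrM mulrC.
have := ffact4_ge R (_ : (2 < 3 * m)%N) => /(_ ltac:(lia)) H3.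
rewrite -(ler_nat R) natrD [(2 * _)%:R]natrM [(8 * _)%:R]natrM => H2.
move: H2 H3; rewrite HC [(3 * m)%:R]natrM => H2 H3.
have x0 : 0 <= m%:R :> R by [].
have q0 : 0 <= pi ^+ 2 :> R by exact: sqr_ge0.
have q1 : pi ^+ 2 <= 10 :> R.
  have p0 := pi_gt0 R; have p1 := pi_lt R; nra.
move: (pi ^+ 2) q0 q1 H1 => q q0 q1 H1.
move: H1 H2 H3; move: (quad_sum _)%:R 'C(_, _)%:R (crossing_number P)%:R => S c k.
move: m%:R x0 => x x0 H1 H2 H3.
(* The bounds combine to [8 * k >= 24 * c - (51 + 2 * q) * x ^+ 4 - 216 * x ^+ 3]. Replacing
   [81 * x ^+ 4] by [24 * c + 162 * x ^+ 3] leaves the coefficient [3 * (30 - 2 * q) / 81] of [c].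
   With [q <= 10] the cubic loss is at most [(318 + 4 * q) / 8 < 54 = 2 * 3 ^ 3]. *)
have h4 : 0 <= (51 + 2 * q) * (24 * c - ((3 * x) ^+ 4 - 6 * (3 * x) ^+ 3)).
  by rewrite mulr_ge0 ?subr_ge0 //; lra.
have h3 : 0 <= (10 - q) * x ^+ 3 by rewrite mulr_ge0 ?subr_ge0 ?exprn_ge0.
have h3' : 0 <= x ^+ 3 by rewrite exprn_ge0.
lra.
Qed.

Theorem theorem1 (R : realType) :
  (exists c : R, 0 < c /\
    forall (n : nat) (P : {fset 'rV[R]_2}),
      (0 < n)%N -> (3 %| n)%N -> #|` P| = n ->
      general_position P -> three_decomposable P ->
      (crossing_number P)%:R
        >= 2 / 27 * (15 - pi ^+ 2) * 'C(n, 4)%:R - c * n%:R ^+ 3) /\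
  2 / 27 * (15 - pi ^+ 2) > 380 / 10 ^+ 3 + 29 / 10 ^+ 6 :> R.
Proof.
split; last exact: pi_num.
exists 2; split => // n P n0 /dvdnP[m nE] Pn gp dec.
have {}nE : n = (3 * m)%N by rewrite nE mulnC.
rewrite nE; apply: crossing_number_ge => //; last by rewrite Pn.
by move: n0; rewrite nE; case: m {nE}.
Qed.
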